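(* Let $K$ be a field, let $I$ be a squarefree lexsegment ideal of $S=K[x_1,\ldots,x_n]$ and let $\mathbf{a}=(a_1,\ldots,a_n)\in\mathbb{Z}_{>0}^n$. Then the ideal $I^{[\mathbf{a}]}$ is componentwise linear if and only if both of the following conditions hold: (1) For each $\ell\in[n]$ with $a_\ell\ge 2$, there do not exist $u,v\in G(I)$ such that (i) $x_\ell$ divides $v$, (ii) $v/x_\ell$ divides $u$, and (iii) $\deg u>\deg v$. (2) There exists a (possibly empty) subset $\{i_1,\ldots,i_s\}\subseteq[n]$ with $i_1<\cdots<i_s$ such that $a_{i_1}\ge 2,\ldots,a_{i_s}\ge 2$; $a_k=1$ for each $k\in[n]\setminus\{i_1,\ldots,i_s\}$; and, for each $2\le j\le s$, if $u\in G(I)$ is divisible by $x_{i_j}$, then $u$ is divisible by $x_{i_{j-1}}$ as well.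
   Context: $S=K[x_1,\ldots,x_n]$ is the polynomial ring in $n$ variables over a field $K$ with the standard grading $\deg x_1=\cdots=\deg x_n=1$, and $[n]=\{1,\ldots,n\}$. For a monomial ideal $I$ of $S$, $G(I)$ denotes its unique minimal set of monomial generators. Let $<_{\mathrm{lex}}$ be the lexicographic order on $S$ induced by $x_1>\cdots>x_n$. A squarefree monomial ideal $I$ of $S$ (not necessarily generated in a single degree) is squarefree lexsegment if for any squarefree monomial $u\in I$ and any squarefree monomial $v\in S$ with $\deg u=\deg v$ and $u<_{\mathrm{lex}}v$, one has $v\in I$. For $\mathbf{a}=(a_1,\ldots,a_n)\in\mathbb{Z}_{>0}^n$ and a squarefree monomial $u=x_{i_1}\cdots x_{i_d}$ with $1\le i_1<\cdots<i_d\le n$, set $u^{[\mathbf{a}]}:=x_{i_1}^{a_{i_1}}\cdots x_{i_d}^{a_{i_d}}$. For a squarefree monomial ideal $I$ of $S$, $I^{[\mathbf{a}]}$ is the monomial ideal with $G(I^{[\mathbf{a}]})=\{u^{[\mathbf{a}]} : u\in G(I)\}$. For a homogeneous ideal $I$ of $S$ and an integer $j$, $I_{\langle j\rangle}$ denotes the ideal of $S$ generated by all homogeneous polynomials of degree $j$ belonging to $I$. The ideal $I$ is componentwise linear if $I_{\langle j\rangle}$ has a linear resolution for all $j$ (with the usual convention that the zero ideal has a linear resolution). An ideal $L$ generated by homogeneous elements of a single degree $d$ has a linear resolution if its graded Betti numbers satisfy $\beta_{p,q}(L)=\dim_K \operatorname{Tor}_p^S(K,L)_q=0$ whenever $q\ne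 p+d$. *)

(* Defs.v *)
From HB Require Import structures.
From mathcomp Require Import all_boot all_order all_algebra.
From mathcomp Require Export mpoly.
From Stdlib Require Import Classical_Prop.

Set Implicit Arguments.
Unset Strict Implicit.
Unset Printing Implicit Defensive.

Import GRing.Theory.
Local Open Scope ring_scope.

(* Ideals are Prop-valued predicates on {mpoly K[n]}: the [idealr] structure of
   MathComp only covers proper ideals with decidable membership, whereas the
   zero ideal and the unit ideal are both legitimate here.  The variable x_i of
   the text (1 <= i <= n) is 'X_j with j : 'I_n of value i - 1. *)

Section Ideals.
Variables (K : fieldType) (n : nat).
Local Notation S := {mpoly K[n]}.

Definition ideal_gen (G : S -> Prop) (f : S) : Prop :=
  exists (k : nat) (c g : 'I_k -> S),
    (forall i, G (g i)) /\ f = \sum_i c i * g i.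

Definition monomial_ideal_gen (G : 'X_{1..n} -> Prop) : S -> Prop :=
  ideal_gen (fun f => exists2 m, G m & f = 'X_[m]).

Definition monomial_ideal (I : S -> Prop) : Prop :=
  exists G, forall f, I f <-> monomial_ideal_gen G f.

(* G(I): the monomials of I that are minimal for divisibility.  For a monomial
   ideal this is the least set of monomials generating I, see
   [min_gen_generates] and [min_gen_least]. *)
Definition min_gen (I : S -> Prop) (u : 'X_{1..n}) : Prop :=
  I 'X_[u] /\ forall v, I 'X_[v] -> (v <= u)%MM -> v = u.

Definition squarefree (u : 'X_{1..n}) : Prop := forall i, (u i <= 1)%N.

Definition squarefree_monomial_ideal (I : S -> Prop) : Prop :=
  exists2 G, (forall u, G u -> squarefree u) &
    forall f, I f <-> monomial_ideal_gen G f.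

(* Lexicographic order induced by x_1 > ... > x_n (the canonical order of
   'X_{1..n} compares total degrees first). *)
Definition lex_lt (u v : 'X_{1..n}) : Prop :=
  exists2 i : 'I_n, (u i < v i)%N & forall j : 'I_n, (j < i)%N -> u j = v j.

Definition squarefree_lexsegment (I : S -> Prop) : Prop :=
  squarefree_monomial_ideal I /\
  forall u v, squarefree u -> squarefree v -> mdeg u = mdeg v ->
    lex_lt u v -> I 'X_[u] -> I 'X_[v].

Definition mpow (a : 'I_n -> nat) (u : 'X_{1..n}) : 'X_{1..n} :=
  [multinom (if u i == 0%N then 0%N else a i) | i < n].

(* The minimal generators of this ideal are exactly the u^[a] for u in G(I),
   see [min_gen_ideal_pow]. *)
Definition ideal_pow (a : 'I_n -> nat) (I : S -> Prop) : S -> Prop :=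
  monomial_ideal_gen (fun w => exists2 u, min_gen I u & w = mpow a u).

Definition component (I : S -> Prop) (j : nat) : S -> Prop :=
  ideal_gen (fun f => I f /\ f \is j.-homog).

Definition generated_in_degree (d : nat) (L : S -> Prop) : Prop :=
  exists2 G : S -> Prop, (forall f, G f -> f \is d.-homog) &
    forall f, L f <-> ideal_gen G f.

End Ideals.

Section Complexes.
Variables (K : fieldType) (n : nat) (B : finType).
Local Notation S := {mpoly K[n]}.
Variables (hdeg : B -> nat) (D : B -> B -> S).

(* A chain is a family of coefficients on the basis B of a free S-module. *)
Definition in_hdeg (p : nat) (f : {ffun B -> S}) : Prop :=
  forall b, hdeg b <> p -> f b = 0.

Definition differential (f : {ffun B -> S}) : {ffun B -> S} :=
  [ffun c => \sum_b f b * D b c].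

End Complexes.

(* Finite graded free resolutions of the S-module K = S/(x_1, ..., x_n):
   the element b of the basis generates a copy of S(- internal_deg b) sitting
   in homological degree hom_deg b, and is mapped by the differential to
   \sum_c diff b c * c.  As the variables act by 0 on K, the augmentation to K
   only sees constant coefficients. *)
Record free_resolution (K : fieldType) (n : nat) := FreeResolution {
  basis : finType;
  hom_deg : basis -> nat;
  internal_deg : basis -> nat;
  diff : basis -> basis -> {mpoly K[n]};
  aug : basis -> K;
  diff_hom_deg : forall b c, diff b c != 0 -> hom_deg b = (hom_deg c).+1;
  diff_homog : forall b c m,
    m \in msupp (diff b c) -> (mdeg m + internal_deg c)%N = internal_deg b;
  aug_deg : forall b, aug b != 0 -> hom_deg b = 0%N /\ internal_deg b = 0%N;
  aug_surj : forall x : K, exists2 f : {ffun basis -> {mpoly K[n]}},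
    in_hdeg hom_deg 0 f & \sum_b aug b * (f b)@_0%MM = x;
  exact_aug : forall f : {ffun basis -> {mpoly K[n]}}, in_hdeg hom_deg 0 f ->
    (\sum_b aug b * (f b)@_0%MM = 0 <->
     exists2 g, in_hdeg hom_deg 1 g & f = differential diff g);
  exact_diff : forall p (f : {ffun basis -> {mpoly K[n]}}),
    in_hdeg hom_deg p.+1 f ->
    (differential diff f = 0 <->
     exists2 g, in_hdeg hom_deg p.+2 g & f = differential diff g)
}.

Section Tor.
Variables (K : fieldType) (n : nat) (F : free_resolution K n).
Local Notation S := {mpoly K[n]}.
Variable L : S -> Prop.

(* The component of degree q of F_p (x)_S L, a direct sum of shifted copies
   of L. *)
Definition tensor_chain (p q : nat) (f : {ffun basis F -> S}) : Prop :=
  [/\ in_hdeg (@hom_deg _ _ F) p f,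
      forall b, L (f b)
    & forall b m, m \in msupp (f b) -> (mdeg m + internal_deg b)%N = q].

Definition tensor_cycle (p q : nat) (f : {ffun basis F -> S}) : Prop :=
  tensor_chain p q f /\ differential (@diff _ _ F) f = 0.

Definition tensor_boundary (p q : nat) (f : {ffun basis F -> S}) : Prop :=
  exists2 g, tensor_chain p.+1 q g & f = differential (@diff _ _ F) g.

(* dim_K Tor_p^S(K, L)_q = r: there are r cycles whose classes form a basis of
   H_p(F (x)_S L)_q. *)
Definition tor_dim (p q r : nat) : Prop :=
  exists z : 'I_r -> {ffun basis F -> S},
  [/\ forall i, tensor_cycle p q (z i),
      forall f, tensor_cycle p q f ->
        exists k : 'I_r -> K, tensor_boundary p q (f - \sum_i k i *: z i)
    & forall k : 'I_r -> K, tensor_boundary p q (\sum_i k i *: z i) ->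
        forall i, k i = 0].

End Tor.

Section MonomialIdealFacts.
Variables (K : fieldType) (n : nat).
Local Notation S := {mpoly K[n]}.
Implicit Types (I : S -> Prop) (G : 'X_{1..n} -> Prop).

Lemma mono_ideal_memP G (f : S) : monomial_ideal_gen G f <->
  forall m, m \in msupp f -> exists2 g, G g & (g <= m)%MM.
Proof.
split.
- case=> k [c [g [Gg ->]]] m /msupp_sum_le /flattenP [s /mapP [i _ ->]].
  case: (Gg i) => u Gu ->; rewrite (perm_mem (msuppMX _ _)) => /mapP [w _ ->].
  by exists u => //; exact: lem_addr.
- move=> H.
  have /fin_all_exists [h hP] : forall i : 'I_(size (msupp f)),
    exists g, G g /\ (g <= nth 0%MM (msupp f) i)%MM.
    by move=> i; case: (H (nth 0%MM (msupp f) i)) => [|g ? ?];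
      [exact: mem_nth | exists g].
  exists (size (msupp f)),
    (fun i : 'I_(size (msupp f)) => f@_(nth 0%MM (msupp f) i) *: 'X_[nth 0%MM (msupp f) i - h i]),
    (fun i => 'X_[h i]); split.
    by move=> i; exists (h i) => //; case: (hP i).
  rewrite {1}[f]mpolyE (big_nth 0%MM) big_mkord; apply: eq_bigr => i _.
  by rewrite -scalerAl -mpolyXD submK //; case: (hP i).
Qed.

Lemma mono_idealXP G (m : 'X_{1..n}) : monomial_ideal_gen (K := K) G 'X_[m] <->
  exists2 g, G g & (g <= m)%MM.
Proof.
rewrite mono_ideal_memP; split=> [H|H m'].
  by apply: H; rewrite msuppX mem_head.
by rewrite msuppX inE => /eqP ->.
Qed.

Lemma lem_mdeg (u v : 'X_{1..n}) : (u <= v)%MM -> (mdeg u <= mdeg v)%N.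
Proof. by move=> uv; rewrite -(submK uv) mdegD leq_addl. Qed.

Lemma lem_anti (u v : 'X_{1..n}) : (u <= v)%MM -> (v <= u)%MM -> u = v.
Proof.
move=> /mnm_lepP uv /mnm_lepP vu; apply/mnmP => i.
by apply/eqP; rewrite eqn_leq uv vu.
Qed.

Lemma min_gen_least I G u :
  (forall f, I f <-> monomial_ideal_gen G f) -> min_gen I u -> G u.
Proof.
move=> IG [/IG/mono_idealXP [g Gg gu] minu].
suff <- : g = u by [].
by apply: minu => //; apply/IG/mono_idealXP; exists g => //; exact: lepm_refl.
Qed.

Lemma min_gen_below I (m : 'X_{1..n}) : I 'X_[m] ->
  exists2 u, min_gen I u & (u <= m)%MM.
Proof.
have [d] := ubnP (mdeg m); elim: d m => // d IHd m /ltnSE le_md Im.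
have [[v [Iv vm neq_vm]]|minm] :=
  classic (exists v, [/\ I 'X_[v], (v <= m)%MM & v <> m]).
  case: (IHd v) => [|//|u minu uv].
    apply: leq_trans le_md; rewrite ltn_neqAle lem_mdeg // andbT.
    apply/eqP => eq_d; apply: neq_vm; have eq_m := submK vm.
    have := congr1 (@mdeg n) eq_m.
    rewrite mdegD eq_d -{2}[mdeg m]add0n => /addIn /eqP.
    by rewrite mdeg_eq0 => /eqP eq0; rewrite -eq_m eq0 add0m.
  by exists u => //; exact: lepm_trans uv vm.
exists m; last exact: lepm_refl.
by split=> // v Iv vm; apply: NNPP => neq; apply: minm; exists v.
Qed.

Lemma min_gen_generates I : monomial_ideal I ->
  forall f, I f <-> monomial_ideal_gen (min_gen I) f.
Proof.
case=> G IG f; rewrite IG !mono_ideal_memP; split=> H m /H [g Gg gm].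
  have [u minu ug] : exists2 u, min_gen I u & (u <= g)%MM.
    by apply: min_gen_below; apply/IG/mono_idealXP; exists g => //; exact: lepm_refl.
  by exists u => //; exact: lepm_trans ug gm.
by exists g => //; exact: min_gen_least IG Gg.
Qed.

Lemma min_gen_squarefree I u :
  squarefree_monomial_ideal I -> min_gen I u -> squarefree u.
Proof. by case=> G sqG IG /(min_gen_least IG)/sqG. Qed.

Lemma min_gen_ideal_pow (a : 'I_n -> nat) I w :
  (forall i, 0 < a i)%N -> squarefree_monomial_ideal I ->
  min_gen (ideal_pow a I) w <-> exists2 u, min_gen I u & w = mpow a u.
Proof.
move=> a_gt0 sqI; split; first exact: min_gen_least (fun=> iff_refl _).
case=> u minu ->; split.
  by apply/mono_idealXP; exists (mpow a u); [exists u | exact: lepm_refl].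
move=> v /mono_idealXP [_ [u' minu' ->] le_v] v_le.
suff eq_u : u' = u by apply: lem_anti => //; rewrite -eq_u.
case: minu => _; apply; first by case: minu'.
have /mnm_lepP le := lepm_trans le_v v_le.
apply/mnm_lepP => i; have := le i; rewrite !mnmE.
have := min_gen_squarefree sqI minu' i; have := a_gt0 i.
by case: (u' i) => [|[|]] //; case: (u i) => [|k] //=; case: (a i).
Qed.

End MonomialIdealFacts.

Section Koszul.
Variables (K : fieldType) (n : nat).
Local Notation S := {mpoly K[n]}.
Local Notation chain := {ffun {set 'I_n} -> S}.

(* Koszul complex on x_1, ..., x_n: the basis element J stands for the wedge
   of the e_j, j in J, in increasing order. *)
Definition koszul_sign (j : 'I_n) (J : {set 'I_n}) : K :=
  (-1) ^+ #|[set k in J | (k < j)%N]|.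

Definition koszul_diff (J J' : {set 'I_n}) : S :=
  \sum_(j in J | J :\ j == J') koszul_sign j J *: 'X_j.

Definition koszul_aug (J : {set 'I_n}) : K := (J == set0)%:R.

Local Notation hdeg := (fun J : {set 'I_n} => #|J|).
Local Notation dK := (differential koszul_diff).

Lemma koszul_diffE (f : chain) (J : {set 'I_n}) :
  dK f J = \sum_(j | j \notin J) koszul_sign j J *: (f (j |: J) * 'X_j).
Proof.
rewrite ffunE /koszul_diff.
under eq_bigr do rewrite mulr_sumr big_mkcond /=.
rewrite exchange_big [RHS]big_mkcond /=; apply: eq_bigr => j _.
rewrite -big_mkcond /=; case: ifPn => jJ; last first.
  rewrite big_pred0 // => J1; apply/negP => /andP [_ /eqP eJ].
  by move: jJ; rewrite -eJ setD11.
rewrite (big_pred1 (j |: J)) => [|J1] /=.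
  rewrite -scalerAr /koszul_sign; congr (_ ^+ _ *: _); apply: eq_card => k.
  by rewrite !inE; case: eqP => [->|] //=; rewrite ltnn !andbF.
apply/idP/eqP => [/andP [jJ1 /eqP <-]|->]; first by rewrite setD1K.
by rewrite setU11 setU1K ?eqxx.
Qed.

Lemma mcoeffMXU (p : S) j m :
  (p * 'X_j)@_m = if m j == 0%N then 0 else p@_(m - U_(j)).
Proof.
case: ifPn => [mj|]; last first.
  by rewrite -lep1mP => /submK {1}<-; rewrite addmC mcoeffMX.
apply/eqP; rewrite mcoeff_eq0 (perm_mem (msuppMX _ _)).
by apply: contraL mj => /mapP [m' _ ->]; rewrite mnmDE mnm1E eqxx.
Qed.

Lemma koszul_coeffE (f : chain) J m : (dK f J)@_m =
  \sum_(j | (j \notin J) && (m j != 0%N))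
     koszul_sign j J * (f (j |: J))@_(m - U_(j)).
Proof.
rewrite koszul_diffE raddf_sum /= [RHS]big_mkcondr /=.
by apply: eq_bigr => j _; rewrite mcoeffZ mcoeffMXU; case: eqP; rewrite ?mulr0.
Qed.

Lemma koszul_sign_min (j : 'I_n) (J : {set 'I_n}) :
  (forall k, k \in J -> (j <= k)%N) -> koszul_sign j J = 1.
Proof.
move=> minj; rewrite /koszul_sign (_ : [set k in J | _] = set0) ?cards0 //.
apply/setP => k; rewrite !inE; apply/negP => /andP [/minj].
by rewrite leqNgt => /negP.
Qed.

Lemma koszul_signU1 (i j : 'I_n) (J : {set 'I_n}) : i \notin J ->
  koszul_sign j (i |: J) = (-1) ^+ (i < j)%N * koszul_sign j J.
Proof.
move=> iJ; rewrite /koszul_sign -exprD; congr (_ ^+ _).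
case: ltnP => ij.
  rewrite (_ : [set _ in i |: J | _] = i |: [set k in J | (k < j)%N]).
    by rewrite cardsU1 !inE (negPf iJ).
  by apply/setP => k; rewrite !inE; case: eqP => // ->; rewrite ij.
apply: eq_card => k; rewrite !inE; case: eqP => [->|] //=.
by rewrite ltnNge ij andbF.
Qed.

(* A contracting homotopy: in each multidegree, move the smallest variable
   that occurs from the polynomial part to the exterior part. *)
Definition koszul_strip (j : 'I_n) (p : S) : S :=
  \sum_(m <- msupp p | (m j != 0%N) &&
           [forall i : 'I_n, (i < j)%N ==> (m i == 0%N)]) p@_m *: 'X_[m - U_(j)].

Definition koszul_htpy (f : chain) : chain :=
  [ffun J : {set 'I_n} =>
     \sum_(j in J | [forall k in J, (j <= k)%N]) koszul_strip j (f (J :\ j))].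

Local Notation hK := koszul_htpy.

Lemma koszul_stripE j (p : S) m :
  (koszul_strip j p)@_m =
  if [forall i : 'I_n, (i < j)%N ==> (m i == 0%N)] then p@_(m + U_(j)) else 0.
Proof.
have lowE (m' : 'X_{1..n}) : m' = (m + U_(j))%MM ->
  [forall i : 'I_n, (i < j)%N ==> (m' i == 0%N)] =
  [forall i : 'I_n, (i < j)%N ==> (m i == 0%N)].
  move=> ->; apply: eq_forallb => i; case: ltnP => //= ij.
  by rewrite mnmDE mnm1E; case: (j =P i) ij => [->|_ _]; rewrite ?ltnn ?addn0.
rewrite raddf_sum /=.
transitivity (\sum_(m' <- msupp p | m' == (m + U_(j))%MM)
   if [forall i : 'I_n, (i < j)%N ==> (m i == 0%N)] then p@_m' else 0).
  rewrite big_mkcond [RHS]big_mkcond /=; apply: eq_bigr => m' _.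
  rewrite mcoeffZ mcoeffX.
  case: (m' =P (m + U_(j))%MM) => [eq_m'|neq].
    rewrite (lowE _ eq_m') eq_m' mnmDE mnm1E eqxx addn1 addmK eqxx mulr1 /=.
    by [].
  case: ifP => // /andP []; rewrite -lep1mP => /submK le_m' _.
  by case: eqP => [eq_m|]; rewrite ?mulr0 //; case: neq; rewrite -eq_m le_m'.
case: (boolP (m + U_(j) \in msupp p)%MM) => [in_p|nin_p].
  by rewrite -big_filter (filter_pred1_uniq (msupp_uniq p) in_p) big_seq1.
rewrite (memN_msupp_eq0 nin_p) if_same big_seq_cond big1 // => m' /andP [+ /eqP].
by move=> + eq_m'; rewrite eq_m' (negPf nin_p).
Qed.

Lemma koszul_htpy_in (f : chain) (J : {set 'I_n}) (m : 'X_{1..n}) (j : 'I_n) :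
  j \in J -> (forall k, k \in J -> (j <= k)%N) ->
  (forall i : 'I_n, (i < j)%N -> m i = 0%N) ->
  (hK f J)@_m = (f (J :\ j))@_(m + U_(j)).
Proof.
move=> jJ minj low; rewrite ffunE (big_pred1 j) => [|k] /=.
  rewrite koszul_stripE ifT //; apply/forallP => i; apply/implyP => /low ->.
  by [].
apply/andP/eqP => [[kJ /forallP mink]|->].
  apply/val_inj/eqP; rewrite eqn_leq minj // andbT.
  by have := mink j; rewrite jJ.
by split=> //; apply/forallP => i; apply/implyP => /minj.
Qed.

Lemma koszul_htpy_notin (f : chain) (J : {set 'I_n}) (m : 'X_{1..n}) (i : 'I_n) :
  i \notin J -> (forall k, k \in J -> (i <= k)%N) -> m i != 0%N ->
  (hK f J)@_m = 0.
Proof.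
move=> iJ mini mi; rewrite ffunE raddf_sum big1 //= => j /andP [jJ _].
rewrite koszul_stripE ifF //; apply/negbTE/forallPn; exists i.
rewrite negb_imply mi andbT ltn_neqAle mini // andbT.
by apply: contraNneq iJ => eq_ij; rewrite (val_inj eq_ij : i = j).
Qed.

Lemma koszul_htpyP (f : chain) (J : {set 'I_n}) (m : 'X_{1..n}) :
  (J != set0) || (m != 0%MM) ->
  (hK (dK f) J)@_m + (dK (hK f) J)@_m = (f J)@_m.
Proof.
move=> nz.
have [i0 Ai0] : exists i, (i \in J) || (m i != 0%N).
  case/orP: nz => [/set0Pn [i iJ]|nzm]; first by exists i; rewrite iJ.
  have [/existsP [i mi]|/existsPn m0] := boolP [exists i, m i != 0%N].
    by exists i; rewrite mi orbT.
  case/eqP: nzm; apply/mnmP => i; rewrite mnm0E.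
  by apply/eqP; rewrite -[_ == _]negbK m0.
case: (@arg_minnP _ i0 (fun i => (i \in J) || (m i != 0%N)) val Ai0) => i {}Ai mini.
have minJ k : k \in J -> (i <= k)%N by move=> kJ; apply: mini; rewrite kJ.
have minm k : m k != 0%N -> (i <= k)%N.
  by move=> mk; apply: mini; rewrite mk orbT.
have low (k : 'I_n) : (k < i)%N -> m k = 0%N.
  by move=> ki; apply/eqP; apply: contraTT ki => /minm; rewrite leqNgt.
have gt_i j : j != i -> m j != 0%N -> (i < j)%N.
  move=> neq /minm le; rewrite ltn_neqAle le andbT.
  by apply: contraNneq neq => eq_ij; rewrite (val_inj eq_ij : i = j).
have [iJ|iJ] := boolP (i \in J).
  rewrite (koszul_htpy_in _ iJ minJ low) !koszul_coeffE.
  rewrite (bigD1 i) /= ?setD11 ?mnmDE ?mnm1E ?eqxx ?addn1 //=.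
  rewrite koszul_sign_min ?setD1K ?addmK ?mul1r //; last first.
    by move=> k /setD1P [_ /minJ].
  rewrite -addrA [X in _ + X](_ : _ = 0) ?addr0 //.
  have idx j : (j \notin J :\ i) && ((m + U_(i))%MM j != 0%N) && (j != i) =
               (j \notin J) && (m j != 0%N).
    rewrite !inE mnmDE mnm1E; case: (eqVneq j i) => [->|neq] /=.
      by rewrite iJ andbF.
    by rewrite addn0 andbT.
  rewrite (eq_bigl _ _ idx) -big_split big1 //= => j /andP [jJ mj].
  have neq_ji : j != i by apply: contraNneq jJ => ->.
  have lt_ij := gt_i j neq_ji mj.
  rewrite (@koszul_htpy_in _ _ _ i); first last.
  - by move=> k ki; rewrite mnmBE low.
  - by move=> k /setU1P [->|/minJ //]; exact: ltnW.
  - by rewrite !inE iJ orbT.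
  rewrite -{3}(setD1K iJ) koszul_signU1 ?setD11 // lt_ij expr1 mulN1r mulNr.
  have -> : (j |: J) :\ i = j |: J :\ i.
    apply/setP => k; rewrite !inE.
    by case: (eqVneq k j) => [->|] //=; rewrite neq_ji.
  have -> : (m - U_(j) + U_(i) = m + U_(i) - U_(j))%MM.
    by rewrite ![(_ + U_(i))%MM]addmC addmBA // lep1mP.
  by rewrite subrr.
have mi : m i != 0%N by move: Ai; rewrite (negPf iJ).
rewrite (koszul_htpy_notin _ iJ minJ mi) add0r koszul_coeffE.
rewrite (bigD1 i) ?iJ //= koszul_sign_min // mul1r.
rewrite (@koszul_htpy_in _ _ _ i); first last.
- by move=> k ki; rewrite mnmBE low.
- by move=> k /setU1P [->|/minJ].
- exact: setU11.
rewrite setU1K // submK ?lep1mP // big1 ?addr0 // => j /andP [/andP [jJ mj] ji].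
rewrite (@koszul_htpy_notin _ _ _ i) ?mulr0 //.
- by rewrite !inE negb_or eq_sym ji.
- by move=> k /setU1P [->|/minJ //]; exact: minm.
- by rewrite mnmBE mnm1E (negPf ji) subn0.
Qed.

Lemma koszul_diff0 : dK (0 : chain) = 0.
Proof. by apply/ffunP => J; rewrite !ffunE big1 // => j _; rewrite ffunE mul0r. Qed.

Lemma koszul_htpy0 : hK (0 : chain) = 0.
Proof.
apply/ffunP => J; rewrite !ffunE big1 // => j _.
by rewrite ffunE /koszul_strip msupp0 big_nil.
Qed.

Lemma koszul_dd (f : chain) : dK (dK f) = 0.
Proof.
apply/ffunP => J; rewrite koszul_diffE [RHS]ffunE.
pose t (j k : 'I_n) : S :=
  (koszul_sign j J * koszul_sign k J) *: (f (k |: (j |: J)) * ('X_j * 'X_k)).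
have tC j k : t j k = t k j by rewrite /t setUCA [in RHS]mulrC ['X_k * _]mulrC.
pose P (j k : 'I_n) := [&& j \notin J, k \notin J & (k < j)%N].
transitivity (\sum_j \sum_k ((if P j k then t j k else 0) -
                             (if P k j then t k j else 0))).
  rewrite big_mkcond /=; apply: eq_bigr => j _; rewrite /P.
  case: (boolP (j \in J)) => jJ /=.
    by rewrite big1 // => k _; rewrite !andbF subr0.
  rewrite koszul_diffE mulr_suml scaler_sumr big_mkcond /=.
  apply: eq_bigr => k _; rewrite !inE negb_or [t k j]tC.
  case: (boolP (k \in J)) => kJ /=; first by rewrite andbF subr0.
  rewrite andbT -scalerAl scalerA koszul_signU1 // -mulrA ['X_k * _]mulrC /t.
  case: (ltngtP k j) => [kj|jk|eq_kj] /=.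
  - by rewrite subr0 expr0 mul1r ifT // -val_eqE ltn_eqF.
  - rewrite sub0r expr1 mulN1r mulrN scaleNr ifT // -val_eqE gtn_eqF //.
  - by rewrite subr0 (val_inj eq_kj : k = j) eqxx.
under eq_bigr do rewrite sumrB.
by rewrite sumrB [X in _ - X]exchange_big subrr.
Qed.

Lemma koszul_diff_cond (J J' : {set 'I_n}) m : m \in msupp (koszul_diff J J') ->
  exists2 j, #|J| = #|J'|.+1 & m = U_(j)%MM.
Proof.
move=> /msupp_sum_le /flattenP [s /mapP [j]].
rewrite mem_filter => /andP [/andP [jJ /eqP <-] _] -> /msuppZ_le.
by rewrite msuppX inE => /eqP ->; exists j; rewrite // (cardsD1 j J) jJ.
Qed.

Lemma koszul_diff_hom_deg (J J' : {set 'I_n}) :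
  koszul_diff J J' != 0 -> #|J| = #|J'|.+1.
Proof.
rewrite -msupp_eq0; case: (msupp _) (@koszul_diff_cond J J') => // m s H _.
by case: (H m (mem_head _ _)).
Qed.

Lemma koszul_diff_homog (J J' : {set 'I_n}) m :
  m \in msupp (koszul_diff J J') -> (mdeg m + #|J'|)%N = #|J|.
Proof. by case/koszul_diff_cond => j -> ->; rewrite mdeg1. Qed.

Lemma koszul_aug_deg (J : {set 'I_n}) :
  koszul_aug J != 0 -> #|J| = 0%N /\ #|J| = 0%N.
Proof.
by rewrite /koszul_aug; case: (J =P set0) => [->|]; rewrite ?cards0 ?eqxx.
Qed.

Lemma koszul_augE (f : chain) :
  \sum_J koszul_aug J * (f J)@_0%MM = (f set0)@_0%MM.
Proof.
rewrite (bigD1 set0) //= /koszul_aug eqxx mul1r big1 ?addr0 // => J.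
by move=> /negPf ->; rewrite mul0r.
Qed.

Lemma koszul_aug_surj (x : K) :
  exists2 f : chain, in_hdeg hdeg 0 f & \sum_J koszul_aug J * (f J)@_0%MM = x.
Proof.
exists [ffun J : {set 'I_n} => if J == set0 then x%:MP else 0].
  by move=> J; rewrite ffunE; case: eqP => [->|//]; rewrite cards0.
by rewrite koszul_augE ffunE eqxx mcoeffC eqxx mulr1.
Qed.

Lemma koszul_htpy_hdeg p (f : chain) : in_hdeg hdeg p f -> in_hdeg hdeg p.+1 (hK f).
Proof.
move=> hf J hJ; rewrite ffunE big1 // => j /andP [jJ _].
rewrite hf => [|eJ]; first by rewrite /koszul_strip msupp0 big_nil.
by apply: hJ; rewrite (cardsD1 j J) jJ eJ.
Qed.

Lemma koszul_exact_aug (f : chain) : in_hdeg hdeg 0 f ->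
  (\sum_J koszul_aug J * (f J)@_0%MM = 0 <->
   exists2 g, in_hdeg hdeg 1 g & f = dK g).
Proof.
move=> hf; rewrite koszul_augE; split=> [f0|[g hg ->]]; last first.
  rewrite koszul_coeffE big1 // => j; rewrite mnm0E eqxx andbF //.
have df0 : dK f = 0.
  apply/ffunP => J; rewrite koszul_diffE ffunE big1 // => j jJ.
  by rewrite hf ?mul0r ?scaler0 // cardsU1 jJ.
exists (hK f); first exact: koszul_htpy_hdeg.
apply/ffunP => J; apply/mpolyP => m.
have [/orP nz|] := boolP ((J != set0) || (m != 0%MM)).
  by rewrite -koszul_htpyP; [rewrite df0 koszul_htpy0 ffunE mcoeff0 add0r | apply/orP].
rewrite negb_or !negbK => /andP [/eqP -> /eqP ->].
by rewrite f0 koszul_coeffE big1 // => j; rewrite mnm0E eqxx andbF.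
Qed.

Lemma koszul_exact_diff p (f : chain) : in_hdeg hdeg p.+1 f ->
  (dK f = 0 <-> exists2 g, in_hdeg hdeg p.+2 g & f = dK g).
Proof.
move=> hf; split=> [df0|[g _ ->]]; last exact: koszul_dd.
exists (hK f); first exact: koszul_htpy_hdeg.
apply/ffunP => J; have [->|nzJ] := eqVneq J set0.
  rewrite hf ?cards0 //; apply/mpolyP => m; rewrite mcoeff0.
  rewrite koszul_coeffE big1 // => j /andP [_ mj].
  rewrite setU0 [hK f]/hK ffunE big1 ?mcoeff0 ?mulr0 // => k.
  move=> /andP [/set1P -> _]; rewrite setDv hf ?cards0 //.
  by rewrite /koszul_strip msupp0 big_nil.
apply/mpolyP => m; rewrite -koszul_htpyP ?nzJ //.
by rewrite df0 koszul_htpy0 ffunE mcoeff0 add0r.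
Qed.

Definition koszul : free_resolution K n := FreeResolution
  koszul_diff_hom_deg koszul_diff_homog koszul_aug_deg koszul_aug_surj
  koszul_exact_aug koszul_exact_diff.

End Koszul.

Section Linearity.
Variables (K : fieldType) (n : nat).
Local Notation S := {mpoly K[n]}.

(* beta_{p,q}(L) = r, where Tor_p^S(K, L) is the homology of F (x)_S L for the
   Koszul resolution F of K. *)
Definition graded_betti (L : S -> Prop) (p q r : nat) : Prop :=
  tor_dim (koszul K n) L p q r.

Definition has_linear_resolution (d : nat) (L : S -> Prop) : Prop :=
  generated_in_degree d L /\
  forall p q, q <> (p + d)%N -> graded_betti L p q 0.

Definition componentwise_linear (I : S -> Prop) : Prop :=
  forall j, has_linear_resolution j (component I j).

End Linearity.

(* Main.v *)
(* Only one consequence of the lexsegment property is used: a squarefree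
   monomial of I stays in I when a variable is replaced by an earlier one.  Sets
   A of indices stand for squarefree monomials, and P = {l : a_l >= 2}.

   In a fixed multidegree al, the Koszul complex tensored with a monomial ideal
   L is the chain complex of the simplicial complex of all S with
   x^(al - S) in L.

   Necessity.  Let u, v in G(I) with l in v, l not in u, a_l >= 2 and
   v/x_l | u.  In the multidegree of (x_l u)^[a], and in the component of
   degree the larger of deg u^[a] and deg v^[a], the vertex l is isolated,
   because u is minimal, while any k in u \ v is another vertex; so Tor_1 does
   not vanish in that multidegree.  If (1) fails this contradicts linearity.
   If p < q in P, q in u and p not in u, then (1) forces x_p u/x_q to be a
   minimal generator, and the same obstruction applies.

   Sufficiency.  Sort G(I), first by the number of variables in P, then by the
   sum of the indices.  If w precedes u, then some c in w \ u outside P has the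
   property that x_c u/x_k lies in I, and its generators precede u, for a k in u
   with c < k or k in P.  Hence the u^[a] have linear quotients, by variables
   outside P; as a_c = 1 <= a_k, this persists when only the generators with
   deg u^[a] <= j are kept.  Each such list of generators gives complexes that
   are acyclic except in the degrees of the generators, by contracting along
   one variable outside the colon ideal. *)

Require Import Defs.
From mathcomp Require Import all_boot all_order all_algebra.
From mathcomp Require Import zify.
From Stdlib Require Import Classical_Prop.

Set Implicit Arguments.
Unset Strict Implicit.
Unset Printing Implicit Defensive.

Import GRing.Theory.

(** * Monomials with prescribed support *)

Definition set_mon n (a : 'I_n -> nat) (A : {set 'I_n}) : 'X_{1..n} :=
  [multinom (if i \in A then a i else 0) | i < n].

Local Notation indic := (set_mon (fun=> 1)).

Lemma set_monE n (a : 'I_n -> nat) A i : set_mon a A i = if i \in A then a i else 0.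
Proof. by rewrite mnmE. Qed.

Lemma mdeg_set_mon n (a : 'I_n -> nat) A : mdeg (set_mon a A) = \sum_(i in A) a i.
Proof. by rewrite mdegE [RHS]big_mkcond; apply: eq_bigr => i _; rewrite mnmE. Qed.

Lemma lem_add2l n (w u v : 'X_{1..n}) : (w + u <= w + v)%MM = (u <= v)%MM.
Proof. by apply/mnm_lepP/mnm_lepP => le i; have := le i; rewrite !mnmDE leq_add2l. Qed.

Lemma mdeg_indic n (A : {set 'I_n}) : mdeg (indic A) = #|A|.
Proof. by rewrite mdeg_set_mon sum1_card. Qed.

Lemma indicU1 n (j : 'I_n) (A : {set 'I_n}) : j \notin A ->
  indic (j |: A) = (indic A + U_(j))%MM.
Proof.
move=> jA; apply/mnmP => i; rewrite mnmDE !set_monE mnm1E !inE [i == j]eq_sym.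
by case: eqVneq => [<-|_] /=; rewrite ?(negPf jA) ?addn0.
Qed.

Lemma set_mon_leS n (a : 'I_n -> nat) (A B : {set 'I_n}) :
  A \subset B -> (set_mon a A <= set_mon a B)%MM.
Proof.
move=> sAB; apply/mnm_lepP => i; rewrite !set_monE.
by case: ifP => // /(subsetP sAB) ->.
Qed.

Lemma set_mon_le_sub n (a : 'I_n -> nat) (A B : {set 'I_n}) :
  (forall i, 0 < a i) -> (set_mon a A <= set_mon a B)%MM -> A \subset B.
Proof.
move=> a_gt0 /mnm_lepP le; apply/subsetP => i iA; have := le i.
by rewrite !set_monE iA; have := a_gt0 i; case: (i \in B); lia.
Qed.

Lemma squarefree_indic n (u : 'X_{1..n}) : squarefree u -> exists A, u = indic A.
Proof.
move=> sq; exists [set i | u i != 0]; apply/mnmP => i; rewrite set_monE inE.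
by have := sq i; case: (u i) => [|[]].
Qed.

Lemma indic_squarefree n (A : {set 'I_n}) : squarefree (indic A).
Proof. by move=> i; rewrite set_monE; case: ifP. Qed.

Lemma indic_le_sub1 n (U V : {set 'I_n}) l : l \in V ->
  (indic V - U_(l) <= indic U)%MM <-> V :\ l \subset U.
Proof.
move=> lV; split=> [/mnm_lepP le|/subsetP sVU].
  apply/subsetP => i; rewrite in_setD1 => /andP [il iV]; have := le i.
  by rewrite mnmBE !set_monE mnm1E eq_sym (negPf il) iV; case: (i \in U).
apply/mnm_lepP => i; rewrite mnmBE !set_monE mnm1E.
have := sVU i; rewrite in_setD1 eq_sym.
by case: (l == i) => //=; case: (i \in V) => // /(_ isT) ->.
Qed.

Lemma enum_val_ord_lt n (P : {set 'I_n}) (j k : 'I_#|P|) :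
  j < k -> enum_val j < enum_val k.
Proof.
have srt : sorted (fun x y : 'I_n => x < y) (enum P).
  rewrite {1}/enum_mem; apply: sorted_filter => [x y z|]; first exact: ltn_trans.
  by have := iota_ltn_sorted 0 n; rewrite -val_enum_ord sorted_map -enumT.
move=> jk; set x0 := enum_val j; rewrite {1}/x0 (enum_val_nth x0) [enum_val k](enum_val_nth x0).
apply: (sorted_ltn_nth _ x0 srt) => //; rewrite ?inE -?cardE //.
by move=> x y z; exact: ltn_trans.
Qed.

(** * The Koszul complex in a fixed multidegree *)

Section Multidegree.
Variables (K : fieldType) (n : nat).
Local Open Scope ring_scope.
Local Notation chain := {ffun {set 'I_n} -> {mpoly K[n]}}.
Implicit Types (c b : {set 'I_n} -> K) (al : 'X_{1..n}) (S T : {set 'I_n}).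

(* The strand of the Koszul complex in multidegree [al]: the scalar [c S] is the
   coefficient of x^(al - S) in the component e_S. *)
Definition bnd al c T : K :=
  \sum_(j | (j \notin T) && (al j != 0%N)) koszul_sign K j T * c (j |: T).

Definition strand al c : chain :=
  [ffun S => if (indic S <= al)%MM then c S *: 'X_[al - indic S] else 0].

Lemma indic_leU1 al j T : j \notin T -> (indic T <= al)%MM ->
  (indic (j |: T) <= al)%MM = (al j != 0%N).
Proof.
move=> jT /mnm_lepP le; apply/mnm_lepP/idP => [/(_ j)|alj i].
  by rewrite set_monE setU11 lt0n.
have := le i; rewrite !set_monE in_setU1.
by case: eqVneq => [->|] //=; rewrite lt0n.
Qed.

Lemma subm_indicU1 al j T : j \notin T ->
  (al - indic (j |: T) = al - indic T - U_(j))%MM.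
Proof. by move=> jT; rewrite indicU1 // submDA. Qed.

Lemma indic_le_sub al S T : S \subset T -> (indic T <= al)%MM -> (indic S <= al)%MM.
Proof.
move=> sST; apply: lepm_trans; apply/mnm_lepP => i; rewrite !set_monE.
by case: ifP => // /(subsetP sST) ->.
Qed.

Lemma mcoeff_strand al c S m :
  (strand al c S)@_m = if (indic S + m)%MM == al then c S else 0.
Proof.
rewrite ffunE; case: ifP => le; last first.
  by rewrite mcoeff0; case: eqP le => // <-; rewrite lem_addr.
rewrite mcoeffZ mcoeffX -(inj_eq (@addmI n (indic S))) [(_ + (_ - _))%MM]addmC submK // eq_sym.
by case: eqP => _; rewrite ?mulr1 ?mulr0.
Qed.

Lemma koszul_strand al c :
  differential (koszul_diff K (n:=n)) (strand al c) = strand al (bnd al c).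
Proof.
apply/ffunP => T; apply/mpolyP => m; rewrite koszul_coeffE mcoeff_strand.
case: eqP => [eq_al|neq].
  rewrite /bnd; apply: eq_big => j.
    by case: (boolP (j \in T)) => //= jT; rewrite -eq_al mnmDE set_monE (negPf jT) add0n.
  case/andP=> jT mj; rewrite mcoeff_strand indicU1 // -addmA ifT // -eq_al.
  by rewrite [(U_(j) + _)%MM]addmC submK // lep1mP.
apply: big1 => j /andP [jT mj]; rewrite mcoeff_strand indicU1 // -addmA.
by rewrite [(U_(j) + _)%MM]addmC submK ?lep1mP // ifF ?mulr0 //; apply/eqP.
Qed.

Lemma differential_sum (r : nat) (g : 'I_r -> chain) :
  differential (koszul_diff K (n:=n)) (\sum_k g k) =
  \sum_k differential (koszul_diff K (n:=n)) (g k).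
Proof.
apply/ffunP => T; rewrite ffunE sum_ffunE.
under [RHS]eq_bigr do rewrite ffunE.
rewrite exchange_big; apply: eq_bigr => S _.
by rewrite sum_ffunE mulr_suml.
Qed.

(** The face condition: [x^(al - S)] exists and lies in the ideal generated by [s]. *)
Definition covered (s : seq 'X_{1..n}) al S := has (fun w => (w + indic S <= al)%MM) s.

Lemma covered_le s al S : covered s al S -> (indic S <= al)%MM.
Proof. by case/hasP => w _; apply: lepm_trans; exact: lem_addl. Qed.

Lemma covered_sub s al S T : S \subset T -> covered s al T -> covered s al S.
Proof.
move=> sST /hasP [w ws le]; apply/hasP; exists w => //; apply: lepm_trans le.
apply/mnm_lepP => i; rewrite !mnmDE !set_monE leq_add2l.
by case: ifP => // /(subsetP sST) ->.
Qed.

Lemma bndB al b c T : bnd al (fun S => b S - c S) T = bnd al b T - bnd al c T.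
Proof. by rewrite /bnd -sumrB; apply: eq_bigr => j _; rewrite mulrBr. Qed.

Lemma bndD al b c T : bnd al (fun S => b S + c S) T = bnd al b T + bnd al c T.
Proof. by rewrite /bnd -big_split; apply: eq_bigr => j _; rewrite mulrDr. Qed.

Lemma bnd_bnd al c T : (indic T <= al)%MM -> bnd al (bnd al c) T = 0.
Proof.
move=> le; have := koszul_dd (strand al c); rewrite !koszul_strand.
move/ffunP/(_ T)/(congr1 (mcoeff (al - indic T)%MM)).
by rewrite mcoeff_strand ffunE mcoeff0 addmC submK ?eqxx.
Qed.

(* Written with the last generator at the head of the list. *)
Fixpoint linear_quotients (s : seq 'X_{1..n}) : Prop :=
  if s is g :: s' then
    linear_quotients s' /\
    forall w, w \in s' -> exists (i : 'I_n) v,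
      [/\ (g i < w i)%N, v \in s' & (v <= g + U_(i))%MM]
  else True.

Lemma koszul_sign_sqr (j : 'I_n) T : koszul_sign K j T * koszul_sign K j T = 1.
Proof. exact: sqrr_sign. Qed.

Lemma koszul_sign_anti (i j : 'I_n) T : i != j -> i \notin T -> j \notin T ->
  koszul_sign K j (i |: T) * koszul_sign K i (j |: T) =
  - (koszul_sign K i T * koszul_sign K j T).
Proof.
move=> neq iT jT; rewrite !koszul_signU1 //.
have [ij|ji|/val_inj eq_ij] := ltngtP i j; last by rewrite eq_ij eqxx in neq.
  by rewrite expr1 expr0 mul1r mulN1r mulNr mulrC.
by rewrite expr1 expr0 mul1r mulN1r mulrN mulrC.
Qed.

(** * Adding one generator whose colon ideal is generated by variables *)

Section Contraction.
Variables (g : 'X_{1..n}) (s : seq 'X_{1..n}) (al : 'X_{1..n}).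
Hypothesis quot_var : forall w, w \in s -> exists (i : 'I_n) v,
  [/\ (g i < w i)%N, v \in s & (v <= g + U_(i))%MM].

(** The variables in the colon ideal by [g] of the ideal generated by [s]. *)
Let colon i := has (fun v => (v <= g + U_(i))%MM) s.

(** Since the colon ideal is generated by variables, whether the multiple [x^(al - S)] of [g] lies
    in the ideal of [s] can be tested one variable at a time. *)
Lemma covered_colon S : (g + indic S <= al)%MM -> covered s al S =
  [exists i, colon i && (g i + (i \in S) < al i)%N].
Proof.
move=> /mnm_lepP le; apply/idP/existsP => [/hasP [w ws /mnm_lepP le_w]|].
  have [i [v [ltgw vs le_v]]] := quot_var ws; exists i.
  apply/andP; split; first by apply/hasP; exists v.
  by have := le_w i; rewrite mnmDE set_monE; case: (i \in S); lia.
case=> i /andP [/hasP [v vs /mnm_lepP le_v] lti].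
apply/hasP; exists v => //; apply/mnm_lepP => k.
have := le_v k; have := le k; rewrite !mnmDE !set_monE mnm1E.
by case: eqVneq lti => [<-|_] /=; case: (_ \in S); lia.
Qed.

(** Modulo the faces covered by [s], the faces covered by [g] form a cone over any variable [i]
    outside the colon ideal with [g i < al i]: inserting or deleting [i] changes neither condition.
    Without such an [i], a face not covered by [s] forces [al = g + indic S], which is the excluded
    degree. *)
Lemma contraction p c : (mdeg g + p)%N <> mdeg al ->
  (forall S, c S != 0 -> #|S| = p /\ covered (g :: s) al S) ->
  (forall T, bnd al c T = 0) ->
  exists b, (forall S, b S != 0 -> #|S| = p.+1 /\ covered (g :: s) al S) /\
    (forall S, c S - bnd al b S != 0 -> #|S| = p /\ covered s al S).
Proof.
move=> neq_deg supp_c cyc.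
have [/existsP [i /andP [ci lti]]|none] := boolP [exists i, ~~ colon i && (g i < al i)%N].
  (* The cone operator with apex [i], set to zero where [S :\ i] is already covered by [s], so that
     [b] lives on faces covered by [g]. *)
  pose b S := if (i \in S) && ~~ covered s al (S :\ i)
              then koszul_sign K i (S :\ i) * c (S :\ i) else 0.
  have supp_b S : b S != 0 -> #|S| = p.+1 /\ covered (g :: s) al S.
    rewrite /b; case: ifP => [/andP [iS ncov]|]; last by rewrite eqxx.
    rewrite mulf_eq0 negb_or => /andP [_ /supp_c [cardS]].
    rewrite (cardsD1 i) iS cardS => cov; split=> //; apply/orP; left.
    move: cov; rewrite /covered /= -/(covered s al _) (negPf ncov) orbF.
    rewrite -{2}(setD1K iS) indicU1 ?setD11 // => /mnm_lepP le.
    apply/mnm_lepP => k; have := le k; rewrite !mnmDE mnm1E.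
    by case: eqVneq => [<-|_]; rewrite ?addn0 // set_monE setD11; lia.
  have ali : al i != 0 by lia.
  exists b; split=> // T nz.
  have [cardT|neqT] := eqVneq #|T| p; last first.
    have cT : c T = 0 by apply/eqP; apply: contraNT neqT => /supp_c [->].
    move: nz; rewrite cT /bnd big1 ?subr0 ?eqxx // => j /andP [jT _].
    apply/eqP; rewrite mulf_eq0; apply/orP; right; apply: contraNT neqT.
    by move=> /supp_b [+ _]; rewrite cardsU1 jT add1n => /eqP.
  split=> //; apply: contraNT nz => ncovT; rewrite subr_eq0; apply/eqP.
  have [covT|/negPf nT] := boolP (covered (g :: s) al T); last first.
    rewrite /bnd big1 => [|j /andP [jT _]].
      by apply/eqP; apply: contraFT nT => /supp_c [].
    apply/eqP; rewrite mulf_eq0; apply/orP; right; apply: contraFT nT.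
    by move=> /supp_b [_]; apply: covered_sub; exact: subsetUr.
  have leT : (g + indic T <= al)%MM.
    by move: covT; rewrite /covered /= -/(covered s al _) (negPf ncovT) orbF.
  have [iT|iT] := boolP (i \in T); last first.
    rewrite /bnd (bigD1 i) ?iT //= big1 ?addr0 => [|j /andP [/andP [jT _] ji]].
      by rewrite /b setU11 setU1K // ncovT mulrA koszul_sign_sqr mul1r.
    by rewrite /b !inE eq_sym (negPf ji) (negPf iT) mulr0.
  set R := T :\ i; have iR : i \notin R by rewrite setD11.
  have TE : T = i |: R by rewrite setD1K.
  have ncovR : ~~ covered s al R.
    apply: contra ncovT; rewrite !covered_colon //; last first.
      apply: lepm_trans leT; apply/mnm_lepP => k; rewrite !mnmDE !set_monE leq_add2l.
      by rewrite /R in_setD1; case: eqP => //= _; case: (k \in T).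
    case/existsP => k /andP [ck ltk]; apply/existsP; exists k; rewrite ck /=.
    by move: ltk; rewrite in_setD1; case: (eqVneq k i) ck ci => [->|] // ->.
  (* For [i] in [T], the cycle condition at [T :\ i] expresses [c T] through the other [c (j |: R)];
     by [koszul_sign_anti] this is [bnd al b T]. *)
  have := cyc R; rewrite /bnd (bigD1 i) ?iR //= -TE => cycR.
  have idx j : (j \notin R) && (al j != 0%N) && (j != i) = (j \notin T) && (al j != 0%N).
    by rewrite TE !inE negb_or; case: (j == i); rewrite ?andbF ?andbT.
  rewrite (eq_bigl _ _ idx) in cycR.
  transitivity (- koszul_sign K i R * (\sum_(j | (j \notin T) && (al j != 0%N))
      koszul_sign K j R * c (j |: R))).
    rewrite mulNr; apply/eqP; rewrite -addr_eq0 -[c T]mul1r -(koszul_sign_sqr i R).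
    by rewrite -mulrA -mulrDr cycR mulr0.
  rewrite mulr_sumr; apply: eq_bigr => j /andP [jT _].
  have ji : i != j by apply: contraNneq jT => <-.
  have jR : j \notin R by apply: contra jT; rewrite TE !inE => ->; rewrite orbT.
  have -> : b (j |: T) = koszul_sign K i (j |: R) * c (j |: R).
    have eqR : (j |: T) :\ i = j |: R.
      by apply/setP => k; rewrite !inE; case: (eqVneq k i) => [->|] //=; rewrite (negPf ji).
    rewrite /b eqR in_setU1 iT orbT /= ifT //.
    by apply: contra ncovR; apply: covered_sub; exact: subsetUr.
  by rewrite mulrA TE koszul_sign_anti // mulrA mulNr.
exists (fun=> 0); split=> [S|S]; first by rewrite eqxx.
rewrite /bnd big1 ?subr0 => [|j _]; last by rewrite mulr0.
move=> /supp_c [cardS cov]; split=> //.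
move: cov; rewrite /covered /= -/(covered s al _) => /orP [le|//].
rewrite covered_colon //; apply: contraT => nex; case: neq_deg.
suff -> : al = (g + indic S)%MM by rewrite mdegD mdeg_indic cardS.
apply/mnmP => i; have /mnm_lepP/(_ i) := le; rewrite !mnmDE set_monE.
have := existsPn nex i; have := existsPn none i; rewrite negb_and.
by case: (colon i); case: (i \in S) => /=; lia.
Qed.
End Contraction.

(** Induction on the list: [contraction] moves the cycle, up to a boundary, off the head generator
    and onto the tail. *)
Lemma strand_acyclic s al p c : linear_quotients s ->
  (forall w, w \in s -> (mdeg w + p)%N <> mdeg al) ->
  (forall S, c S != 0 -> #|S| = p /\ covered s al S) ->
  (forall T, bnd al c T = 0) ->
  exists b, (forall S, b S != 0 -> #|S| = p.+1 /\ covered s al S) /\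
    forall T, bnd al b T = c T.
Proof.
elim: s c => [|g s IHs] c /=.
  move=> _ _ supp_c _; exists (fun=> 0); split=> [S|T]; first by rewrite eqxx.
  rewrite /bnd big1 => [|j _]; last by rewrite mulr0.
  by apply/esym/eqP/contraT => /supp_c [].
move=> [lq quot_var] neq_deg supp_c cyc.
have [b1 [supp_b1 supp_c1]] := contraction quot_var (neq_deg _ (mem_head _ _)) supp_c cyc.
have [|||b2 [supp_b2 b2E]] := IHs (fun S => c S - bnd al b1 S) lq.
- by move=> w ws; apply: neq_deg; rewrite inE ws orbT.
- exact: supp_c1.
- move=> T; have [le|nle] := boolP (indic T <= al)%MM.
    by rewrite bndB cyc bnd_bnd // subr0.
  rewrite /bnd big1 // => j _; apply/eqP; rewrite mulf_eq0; apply/orP; right.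
  apply: contraNT nle => /supp_c1 [_ /covered_le].
  by apply: indic_le_sub; exact: subsetUr.
exists (fun S => b1 S + b2 S); split=> [S nz|T]; last by rewrite bndD b2E addrC subrK.
have [b1S|/supp_b1 //] := eqVneq (b1 S) 0.
have [|cardS cov] := supp_b2 S; first by move: nz; rewrite b1S add0r.
by split=> //; rewrite /covered /= -/(covered s al S) cov orbT.
Qed.

End Multidegree.

(** * Components of monomial ideals *)

Section Components.
Variables (K : fieldType) (n : nat).
Local Notation S := {mpoly K[n]}.
Implicit Types (G : 'X_{1..n} -> Prop) (m w : 'X_{1..n}).

Lemma mnm_between w m j : (w <= m)%MM -> mdeg w <= j <= mdeg m ->
  exists2 x : 'X_{1..n}, (w <= x)%MM && (x <= m)%MM & mdeg x = j.
Proof.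
move=> wm /andP [wj jm]; have [d dE] : exists d, d = j - mdeg w by exists (j - mdeg w).
elim: d w dE wm wj => [|d IHd] w dE wm wj.
  by exists w; rewrite ?lepm_refl ?wm //; lia.
have [i lti] : exists i, w i < m i.
  apply: NNPP => nex; have : mdeg m <= mdeg w.
    apply/lem_mdeg/mnm_lepP => i; rewrite leqNgt; apply/negP => lti.
    by apply: nex; exists i.
  by lia.
have wUm : (w + U_(i) <= m)%MM.
  apply/mnm_lepP => k; rewrite mnmDE mnm1E; have /mnm_lepP/(_ k) := wm.
  by case: eqVneq lti => [<-|_]; lia.
have [|||x /andP [wx xm] degx] := IHd (w + U_(i))%MM; rewrite ?mdegD ?mdeg1 //; try lia.
by exists x => //; rewrite xm andbT; apply: lepm_trans wx; exact: lem_addr.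
Qed.

(** A monomial [m] is a multiple of a degree [j] monomial of the ideal exactly when some degree [j]
    monomial fits between a generator and [m]; [mnm_between] supplies it whenever the degrees
    allow. *)
Lemma component_monomialP G j (f : S) :
  component (monomial_ideal_gen G) j f <->
  forall m, m \in msupp f ->
    exists w, [/\ G w, (w <= m)%MM & mdeg w <= j <= mdeg m].
Proof.
split=> [[k [c [g [gP ->]]]] m|H].
  move=> /msupp_sum_le /flattenP [s /mapP [i _ ->]] /msuppM_le /allpairsP.
  move=> [[m1 m2] /= [_ m2g ->]]; have [/mono_ideal_memP Jg hg] := gP i.
  have [w Gw wm] := Jg _ m2g; exists w; split=> //.
    by apply: lepm_trans wm _; exact: lem_addl.
  by rewrite -(dhomog_mf hg m2g) mdegD leq_addl andbT lem_mdeg.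
have /mono_ideal_memP [k [c [g [gP fE]]]] : forall m, m \in msupp f ->
    exists2 x, (monomial_ideal_gen (K := K) G 'X_[x] /\ mdeg x = j) & (x <= m)%MM.
  move=> m /H [w [Gw wm degs]].
  have [x /andP [wx xm] degx] := mnm_between wm degs.
  by exists x => //; split=> //; apply/mono_idealXP; exists w.
exists k, c, g; split=> // i; have [x [Jx <-] ->] := gP i.
by split=> //; apply/dhomogP => m; rewrite msuppX inE => /eqP ->.
Qed.

Lemma generated_component (J : S -> Prop) j : generated_in_degree j (component J j).
Proof. by exists (fun f => J f /\ f \is j.-homog)%R => [f []|f]. Qed.

Local Open Scope ring_scope.

(** A Tor of dimension 0 has an empty basis, so its vanishing means that each cycle is a
    boundary. *)
Lemma linear_resolutionP j (L : S -> Prop) : generated_in_degree j L ->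
  has_linear_resolution j L <->
  forall p q, q <> (p + j)%N -> forall f,
    tensor_cycle (F := koszul K n) L p q f -> tensor_boundary (F := koszul K n) L p q f.
Proof.
move=> gen; split=> [[_ H] p q neq f cyc|H].
  have [z [_ /(_ f cyc) [k]]] := H p q neq.
  by rewrite big_ord0 subr0.
split=> // p q neq; exists (fun=> 0); split=> [[]//|f cyc|k _ []//].
by exists (fun=> 0); rewrite big_ord0 subr0; apply: H.
Qed.

(** A cycle splits into strands, one per multidegree. For [q < p + j] there are no nonzero chains;
    for [q > p + j] no generator [w] has [mdeg w + p = q], and [strand_acyclic] applies to each
    strand. *)
Lemma linear_quotients_component G j (s : seq 'X_{1..n}) : linear_quotients s ->
  (forall w, w \in s <-> G w /\ (mdeg w <= j)%N) ->
  has_linear_resolution j (component (monomial_ideal_gen (K := K) G) j).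
Proof.
move=> lq sP; apply/linear_resolutionP; first exact: generated_component.
move=> p q neq f [[hdeg_f Lf deg_f] df0].
have cov_f A m : m \in msupp (f A) ->
    [/\ #|A| = p, (mdeg m + p)%N = q, (j <= mdeg m)%N & covered s (m + indic A)%MM A].
  move=> mA; have cardA : #|A| = p.
    have [//|/eqP neqA] := eqVneq #|A| p.
    by move: mA; rewrite (hdeg_f A neqA) msupp0.
  have [w [Gw wm /andP [wj jm]]] := (component_monomialP G j (f A)).1 (Lf A) m mA.
  split=> //; first by rewrite -cardA; exact: deg_f mA.
  apply/hasP; exists w; first exact/sP.
  by apply/mnm_lepP => i; rewrite !mnmDE leq_add2r; move/mnm_lepP: wm.
(* The multidegrees met by [f], without repetition, so that each coefficient is counted once when
   the strands are added up. *)
pose als := undup [seq (m + indic A)%MM | A <- enum {set 'I_n}, m <- msupp (f A)].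
have alsP al : al \in als -> exists A m, m \in msupp (f A) /\ al = (m + indic A)%MM.
  rewrite mem_undup => /allpairsPdep [A [m [_ mA ->]]]; by exists A, m.
have als_mem A m : m \in msupp (f A) -> (m + indic A)%MM \in als.
  by move=> mA; rewrite mem_undup; apply/allpairsPdep; exists A, m; rewrite mem_enum.
pose cf al A := if (indic A <= al)%MM then (f A)@_(al - indic A) else 0.
have strand_cf al A m : (strand al (cf al) A)@_m =
    if (indic A + m)%MM == al then (f A)@_m else 0.
  by rewrite mcoeff_strand /cf; case: eqP => // <-; rewrite lem_addr addmC addmK.
have cov_cf al A : cf al A != 0 -> #|A| = p /\ covered s al A.
  rewrite /cf; case: ifP => [le|]; last by rewrite eqxx.
  by rewrite -mcoeff_msupp => /cov_f [? _ _]; rewrite submK.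
have cyc al T : bnd al (cf al) T = 0.
  have [le|nle] := boolP (indic T <= al)%MM; last first.
    rewrite /bnd big1 // => k _; apply/eqP; rewrite mulf_eq0; apply/orP; right.
    apply: contraNT nle => /cov_cf [_ /covered_le].
    by apply: indic_le_sub; exact: subsetUr.
  move: df0 => /ffunP/(_ T)/(congr1 (mcoeff (al - indic T)%MM)).
  rewrite koszul_coeffE ffunE mcoeff0 => <-; apply: eq_big => k.
    by case: (boolP (k \in T)) => //= kT; rewrite mnmBE set_monE (negPf kT) subn0.
  by case/andP=> kT alk; rewrite /cf indic_leU1 // alk subm_indicU1.
have deg_al al : al \in als -> mdeg al = q.
  by case/alsP=> A [m [/cov_f [cardA degm _ _] ->]]; rewrite mdegD mdeg_indic cardA.
have [lt_q|ge_q] := ltnP q (p + j).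
  have f0 : f = 0.
    apply/ffunP => A; rewrite ffunE; apply/mpolyP => m; rewrite mcoeff0.
    by apply: memN_msupp_eq0; apply/negP => /cov_f [_]; lia.
  exists 0; last by rewrite f0; apply/esym/koszul_diff0.
  split=> [A _|A|A m]; rewrite ffunE ?msupp0 //.
  by apply/component_monomialP => m; rewrite msupp0.
have /fin_all_exists [b bP] : forall k : 'I_(size als), exists b : {set 'I_n} -> K,
    let al := nth 0%MM als k in
    (forall A, b A != 0 -> #|A| = p.+1 /\ covered s al A) /\ bnd al b =1 cf al.
  move=> k; apply: (strand_acyclic (p := p)) => [//||A|T]; [|exact: cov_cf|exact: cyc].
  move=> w /sP [_ degw]; rewrite [mdeg (nth _ _ _)]deg_al ?mem_nth //; lia.
pose g := \sum_(k < size als) strand (nth 0%MM als k) (b k).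
have supp_g A m : m \in msupp (g A) -> exists2 k : 'I_(size als),
    b k A != 0 & nth 0%MM als k = (indic A + m)%MM.
  rewrite mcoeff_msupp sum_ffunE raddf_sum /= => nz; apply: NNPP => nex.
  case/eqP: nz; apply: big1 => k _; rewrite mcoeff_strand; case: eqP => // eq_al.
  by apply/eqP/contraT => nz; case: nex; exists k.
have cov_g A m : m \in msupp (g A) ->
    [/\ #|A| = p.+1, (mdeg m + p.+1)%N = q & exists2 w, w \in s & (w <= m)%MM].
  move=> /supp_g [k nz eq_al]; have [/(_ A nz) [cardA /hasP [w ws le]] _] := bP k.
  have degq := deg_al _ (mem_nth 0%MM (ltn_ord k)); split=> //.
    by rewrite -degq eq_al mdegD mdeg_indic cardA addnC.
  exists w => //; move: le; rewrite eq_al addmC => /mnm_lepP le.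
  by apply/mnm_lepP => i; have := le i; rewrite !mnmDE leq_add2l.
exists g.
  split=> [A neqA|A|A m].
  - apply/mpolyP => m; rewrite mcoeff0; apply: memN_msupp_eq0.
    by apply/negP => /cov_g [].
  - apply/component_monomialP => m /cov_g [_ degm [w /sP [Gw degw] wm]].
    by exists w; split=> //; rewrite degw /=; lia.
  - by move=> /cov_g [cardA degm _]; rewrite /= cardA.
rewrite differential_sum; under eq_bigr do rewrite koszul_strand.
apply/ffunP => A; apply/mpolyP => m; rewrite sum_ffunE raddf_sum /=.
under eq_bigr => k _.
  have -> : (strand (nth 0%MM als k) (bnd (nth 0%MM als k) (b k)) A)@_m =
    if nth 0%MM als k == (m + indic A)%MM then (f A)@_m else 0.
    rewrite mcoeff_strand (bP k).2 -mcoeff_strand strand_cf addmC eq_sym //.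
  over.
rewrite -(big_mkord xpredT (fun k => if nth 0%MM als k == (m + indic A)%MM then (f A)@_m else 0)).
rewrite -(big_nth 0%MM xpredT (fun al => if al == (m + indic A)%MM then (f A)@_m else 0)).
rewrite -big_mkcond /= -big_filter.
have [mA|/memN_msupp_eq0 ->] := boolP (m \in msupp (f A)); last by rewrite big1.
by rewrite (filter_pred1_uniq (undup_uniq _) (als_mem _ _ mA)) big_seq1.
Qed.

(** With [p] and [k] vertices and no edge at [p], the difference of the two vertices is a cycle that
    bounds nothing. The degree hypotheses place it in a Tor_1 off the linear strand. *)
Lemma isolated_vertex_nonlinear G (al : 'X_{1..n}) (p k : 'I_n) g1 g2 :
  p != k -> G g1 -> G g2 -> (g1 + U_(p) <= al)%MM -> (g2 + U_(k) <= al)%MM ->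
  (mdeg g1 + 2 <= mdeg al)%N -> (mdeg g2 + 2 <= mdeg al)%N ->
  (forall i g, i != p -> G g -> ~~ (g + U_(p) + U_(i) <= al)%MM) ->
  ~ componentwise_linear (monomial_ideal_gen (K := K) G).
Proof.
move=> neq_pk Gg1 Gg2 le1 le2 deg1 deg2 isolated lin.
(* The least degree that takes both generators into account; [mdeg al] is at least [j + 2], beyond
   the linear value [1 + j]. *)
pose j := maxn (mdeg g1) (mdeg g2).
have lin_j := (linear_resolutionP (generated_component _ j)).1 (lin j) 1%N (mdeg al) _ _.
pose c (T : {set 'I_n}) : K := (T == [set p])%:R - (T == [set k])%:R.
have c_p : c [set p] = 1 by rewrite /c eqxx (inj_eq set1_inj) (negPf neq_pk) subr0.
have c_k : c [set k] = -1.
  by rewrite /c eqxx (inj_eq set1_inj) eq_sym (negPf neq_pk) sub0r.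
have c0 T : T != [set p] -> T != [set k] -> c T = 0.
  by rewrite /c => /negPf -> /negPf ->; rewrite subr0.
have c1 (T : {set 'I_n}) : #|T| != 1%N -> c T = 0.
  by move=> T1; apply: c0; apply: contraNneq T1 => ->; rewrite cards1.
have indic1 i : indic [set i] = U_(i)%MM.
  by apply/mnmP => x; rewrite set_monE mnm1E inE eq_sym; case: eqP.
have al_ne0 g i : (g + U_(i) <= al)%MM -> al i != 0%N.
  by move=> /mnm_lepP/(_ i); rewrite mnmDE mnm1E eqxx; lia.
have bnd_c T : bnd al c T = 0.
  have [->|/set0Pn [x xT]] := eqVneq T set0.
    rewrite /bnd (bigD1 p) /= ?in_set0 ?(al_ne0 g1) //.
    rewrite (bigD1 k) /= ?in_set0 ?(al_ne0 g2) 1?eq_sym //=.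
    rewrite !koszul_sign_min; try by move=> y; rewrite in_set0.
    rewrite !setU0 c_p c_k !mul1r addrA subrr add0r big1 // => i /andP [/andP [_ ip] ik].
    by rewrite setU0 c0 ?mulr0 // (inj_eq set1_inj).
  rewrite /bnd big1 // => i /andP [iT _]; rewrite c1 ?mulr0 //.
  by rewrite cardsU1 iT (cardsD1 x) xT.
have supp_c A m : m \in msupp (strand al c A) -> [/\ #|A| = 1%N, (mdeg m + 1)%N = mdeg al
    & exists w, [/\ G w, (w <= m)%MM & (mdeg w <= j)%N]].
  rewrite mcoeff_msupp mcoeff_strand;
  case: ((indic A + m)%MM =P al) => [eq_al|]; last by rewrite eqxx.
  have [A1|/c1 ->] := eqVneq #|A| 1%N; last by rewrite eqxx.
  move=> nz; rewrite -eq_al mdegD mdeg_indic A1 addnC; split=> //.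
  have [eqA|neqp] := eqVneq A [set p].
    exists g1; split=> //; last exact: leq_maxl.
    by move: (eq_al) le1; rewrite eqA indic1 => <-; rewrite addmC lem_add2l.
  have [eqA|neqk] := eqVneq A [set k].
    exists g2; split=> //; last exact: leq_maxr.
    by move: (eq_al) le2; rewrite eqA indic1 => <-; rewrite addmC lem_add2l.
  by rewrite c0 ?eqxx in nz.
have [||g] := lin_j _ (strand al c).
- by move=> eq_al; move: deg1 deg2; rewrite /j; lia.
- split; last by rewrite koszul_strand; apply/ffunP => T; rewrite !ffunE bnd_c scale0r if_same.
  split=> [A A1|A|A m /supp_c [A1 degm _]]; last by rewrite /= A1.
    by rewrite ffunE c1 ?scale0r ?if_same //; apply/eqP.
  apply/component_monomialP => m /supp_c [A1 degm [w [Gw wm wj]]].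
  by exists w; split=> //; rewrite wj /=; move: deg1 deg2; rewrite /j; lia.
(* Compare coefficients at [[set p]]: 1 for the cycle, 0 for a boundary, whose summands would come
   from edges through [p]. *)
move=> [_ Lg _] /ffunP/(_ [set p])/(congr1 (mcoeff (al - U_(p))%MM)).
rewrite mcoeff_strand indic1 addmC submK ?lep1mP ?(al_ne0 g1) // eqxx c_p.
rewrite koszul_coeffE big1 => [/eqP|i /andP [ip ali]]; first by rewrite oner_eq0.
apply/eqP; rewrite mulf_eq0; apply/orP; right; rewrite mcoeff_eq0.
apply/negP => /((component_monomialP G j _).1 (Lg _)) [w [Gw wle _]].
move: ip; rewrite inE => ip; move: (isolated i w ip Gw); apply/negP; rewrite negbK.
apply/mnm_lepP => x; move/mnm_lepP/(_ x): wle; move: ali (al_ne0 _ _ le1).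
rewrite !(mnmDE, mnmBE, mnm1E) [p == i]eq_sym (negPf ip) subn0.
case: (eqVneq i x) => [<-|_]; first by rewrite [p == i]eq_sym (negPf ip); lia.
by case: (eqVneq p x) => [<-|_]; lia.
Qed.

End Components.

Lemma card_swap (T : finType) (A : {set T}) i k :
  i \notin A -> k \in A -> #|i |: A :\ k| = #|A|.
Proof. by move=> iA kA; rewrite cardsU1 !inE (negPf iA) andbF [RHS](cardsD1 k) kA. Qed.

(** * Linear quotients from strong stability *)

Section StronglyStable.
Variables (n : nat) (stab : {set 'I_n} -> Prop).
Hypothesis stabS : forall A B : {set 'I_n}, A \subset B -> stab A -> stab B.
Hypothesis stab_swap : forall (A : {set 'I_n}) (i k : 'I_n),
  stab A -> k \in A -> i \notin A -> i < k -> stab (i |: A :\ k).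

(** With [stab A] meaning that the squarefree monomial on [A] lies in [I], these are the supports of
    the elements of [G(I)]. *)
Definition min_stab (A : {set 'I_n}) :=
  stab A /\ forall B, stab B -> B \subset A -> B = A.

Lemma min_stab_below A : stab A -> exists2 B, min_stab B & B \subset A.
Proof.
have [d] := ubnP #|A|; elim: d A => // d IHd A /ltnSE le_d sA.
have [[B [sB BA]]|minA] := classic (exists B, stab B /\ B \proper A).
  have [|C minC CB] := IHd B _ sB; first exact: leq_trans (proper_card BA) le_d.
  by exists C => //; apply: subset_trans CB (proper_sub BA).
exists A => //; split=> // B sB BA; apply/eqP; rewrite eqEproper BA /=.
by apply/negP => prop; apply: minA; exists B.
Qed.

(** Trade the elements of [A :\: B], one at a time, for smaller elements of [B :\: A], until the set
    lies inside [B]. *)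
Lemma stab_shift (A B : {set 'I_n}) : stab A -> #|A| <= #|B| ->
  (forall c k : 'I_n, c \in A :\: B -> k \in B :\: A -> k < c) -> stab B.
Proof.
have [d] := ubnP #|A :\: B|; elim: d A => // d IHd A /ltnSE le_d sA leAB ltBA.
have [/eqP|[c cAB]] := set_0Vmem (A :\: B); first by rewrite setD_eq0 => /stabS; apply.
have [k kBA] : exists k, k \in B :\: A.
  apply/set0Pn; rewrite -card_gt0.
  have := cardsID B A; have := cardsID A B; rewrite setIC.
  by have := cardsD1 c (A :\: B); rewrite cAB; lia.
have lt_kc := ltBA _ _ cAB kBA; move: (cAB) kBA.
rewrite !inE => /andP [cB cA] /andP [kA kB].
have eqD : (k |: A :\ c) :\: B = (A :\: B) :\ c.
  apply/setP => x; rewrite !inE; case: (eqVneq x k) => [->|] /=.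
    by rewrite kB andbF.
  by case: (x == c); case: (x \in B).
apply: (IHd (k |: A :\ c)).
- by rewrite eqD; move: le_d; rewrite (cardsD1 c (A :\: B)) cAB.
- exact: stab_swap.
- by rewrite card_swap.
- move=> c' k'; rewrite eqD !inE => /and3P [_ c'B c'A] /andP [k'A k'B].
  apply: ltBA; rewrite !inE ?c'A ?c'B ?k'B ?andbT //=.
  by apply: contra k'A => k'A; rewrite k'A andbT orbC; case: eqVneq cB => // <-; rewrite k'B.
Qed.

Variable P : {set 'I_n}.
(** [exchange_card] and [initial_bad] are conditions (1) and (2) read on index sets, the second for
    all pairs in [P] and not only for consecutive ones. *)
Hypothesis exchange_card : forall (l : 'I_n) (U V : {set 'I_n}), l \in P ->
  min_stab U -> min_stab V -> l \in V -> V :\ l \subset U -> #|U| <= #|V|.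
Hypothesis initial_bad : forall (p q : 'I_n) (U : {set 'I_n}), p \in P -> q \in P -> p < q ->
  min_stab U -> q \in U -> p \in U.

Lemma min_stab_notin_sub U W i :
  min_stab U -> min_stab W -> i \in U -> i \notin W -> ~~ (W \subset U).
Proof.
move=> [_ minU] [sW _] iU iW; apply/negP => /(minU _ sW) eqWU.
by rewrite eqWU iU in iW.
Qed.

(* Induction on #|W :\: U|.  If W is larger than U, [exchange_card] gives some
   y != i in U but not in W; trading an element of W :\: U for y and passing to a
   minimal generator brings W closer to U. *)
Lemma bad_swap (U W : {set 'I_n}) i : min_stab U -> min_stab W ->
  i \in P -> i \in U -> i \notin W ->
  (forall c k : 'I_n, c \in W :\: U -> k \in U -> k < c) ->
  exists2 c, c \in W :\: U & stab (c |: U :\ i).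
Proof.
have [d] := ubnP #|W :\: U|; elim: d W => // d IHd W /ltnSE le_d.
move=> minU minW iP iU iW ltUW.
have /subsetPn [c cW cU] := min_stab_notin_sub minU minW iU iW.
have cWU : c \in W :\: U by rewrite !inE cU cW.
have [leWU|ltUW_card] := leqP #|W| #|U|.
  exists c => //; apply: (@stab_shift W); first by case: minW.
    by rewrite card_swap.
  move=> c' k; rewrite !inE => /andP [+ c'W] /andP [kW kcU].
  have kU : k \in U.
    by move: kcU; case: (eqVneq k c) => [eq_kc|_ /andP []] //=; rewrite eq_kc cW in kW.
  rewrite !negb_or negb_and negbK => /andP [_ /orP [/eqP ci|c'U]].
    by rewrite ci (negPf iW) in c'W.
  by apply: ltUW => //; rewrite !inE c'W c'U.
have [subUW|/subsetPn [y]] := boolP (U :\ i \subset W).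
  by have := exchange_card iP minW minU iU subUW; lia.
rewrite !inE => /andP [yi yU] yW.
have [|V minV subV] := @min_stab_below (y |: W :\ c).
  by apply: stab_swap => //; [case: minW | exact: ltUW].
have subD : V :\: U \subset (W :\: U) :\ c.
  apply/subsetP => x; rewrite !inE => /andP [xU /(subsetP subV)].
  rewrite !inE xU; case: (eqVneq x y) => [eq_xy|_ /andP [-> ->]] //=.
  by rewrite eq_xy yU in xU.
have subD' : V :\: U \subset W :\: U by apply: subset_trans subD (subsetDl _ _).
have [|||c' /(subsetP subD') c'WU sc'] := IHd V _ minU minV iP iU; last by exists c'.
- by apply: leq_ltn_trans (subset_leq_card subD) _; move: le_d; rewrite (cardsD1 c) cWU.
- apply/negP => /(subsetP subV); rewrite !inE (negPf iW) andbF orbF.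
  by move/eqP => eq_iy; rewrite eq_iy eqxx in yi.
- by move=> c' k /(subsetP subD'); apply: ltUW.
Qed.

(* Codes the lexicographic order on (#|A :&: P|, sum of the indices), the second
   entry being below n.+1 ^ 2. *)
Definition lq_key (A : {set 'I_n}) := n.+1 ^ 2 * #|A :&: P| + \sum_(i in A) i.+1.

Lemma sum_lt_sq (A : {set 'I_n}) : \sum_(i in A) i.+1 < n.+1 ^ 2.
Proof.
apply: (@leq_ltn_trans (\sum_(i in A) n)).
  by apply: leq_sum => i _; exact: ltn_ord.
rewrite sum_nat_const; have := max_card A; rewrite card_ord.
by move=> le; apply: (@leq_ltn_trans (n * n)); [rewrite leq_mul2r le orbT | lia].
Qed.

Lemma lq_key_leq U W : lq_key W <= lq_key U -> #|W :&: P| <= #|U :&: P|.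
Proof.
rewrite /lq_key => le; rewrite leqNgt; apply/negP => lt.
have := sum_lt_sq U; have := leq_mul (leqnn (n.+1 ^ 2)) lt.
by rewrite mulnS; lia.
Qed.

(** Off the common part, the terms of [U] are at most the maximum [b] over [U] and those of [W]
    exceed it, while [W :\: U] is nonempty and has at least as many elements as [U :\: W]. *)
Lemma sum_after (U W : {set 'I_n}) : #|U| <= #|W| -> W :\: U != set0 ->
  (forall c k : 'I_n, c \in W :\: U -> k \in U -> k < c) ->
  \sum_(i in U) i.+1 < \sum_(i in W) i.+1.
Proof.
move=> leUW nzWU ltUW.
rewrite (big_setID W) [X in _ < X](big_setID U) /= setIC ltn_add2l.
have leD : #|U :\: W| <= #|W :\: U|.
  by have := cardsID U W; have := cardsID W U; rewrite setIC; lia.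
pose b := \max_(i in U) i.+1.
have gt0 : 0 < #|W :\: U| by rewrite card_gt0.
apply: (@leq_ltn_trans (#|U :\: W| * b)).
  rewrite -sum_nat_const; apply: leq_sum => i; rewrite inE => /andP [_ iU].
  exact: (@leq_bigmax_cond _ (mem U) (fun i : 'I_n => i.+1)).
apply: (@leq_trans (#|W :\: U| * b.+1)).
  by rewrite mulnS; have := leq_mul leD (leqnn b); lia.
rewrite -sum_nat_const; apply: leq_sum => c cWU; rewrite ltnS.
by apply/bigmax_leqP => k kU; exact: ltUW.
Qed.

(** If some [c] in [W :\: U] precedes some [k] in [U], their swap is stable. Otherwise [W :\: U]
    comes after all of [U], which makes the index sum of [W] larger; so [W] has fewer indices in [P]
    than [U], and [bad_swap] supplies the swap. *)
Lemma linear_quotient_step (U W : {set 'I_n}) : min_stab U -> min_stab W ->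
  W != U -> lq_key W <= lq_key U ->
  exists c k : 'I_n, [/\ c \in W :\: U, c \notin P, k \in U,
    stab (c |: U :\ k) & (c < k) || (k \in P)].
Proof.
move=> minU minW neqWU le_key; have le_bad := lq_key_leq le_key.
have nsub : ~~ (W \subset U).
  by apply: contra neqWU => sWU; apply/eqP; case: minU => _; apply=> //; case: minW.
have [[c [k [cWU kU lt_ck]]]|after] :=
  classic (exists c k : 'I_n, [/\ c \in W :\: U, k \in U & c < k]).
  move: (cWU); rewrite inE => /andP [cU cW].
  have [cP|cP] := boolP (c \in P); last first.
    exists c, k; rewrite lt_ck; split=> //; apply: stab_swap => //; by case: minU.
  suff : #|U :&: P| < #|W :&: P| by lia.
  apply: proper_card; apply/properP; split; last by exists c; rewrite inE ?cW ?cP ?(negPf cU).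
  apply/subsetP => x; rewrite !inE => /andP [xU xP]; rewrite xP andbT.
  apply: (initial_bad xP cP _ minW cW); rewrite ltnNge leq_eqVlt.
  apply/negP => /orP [/eqP eq_cx|lt_cx]; move: cU.
    by rewrite (val_inj eq_cx : c = x) xU.
  by rewrite (initial_bad cP xP lt_cx minU xU).
have ltUW c k : c \in W :\: U -> k \in U -> k < c.
  move=> cWU kU; rewrite ltn_neqAle leqNgt; apply/andP; split; last first.
    by apply/negP => lt; apply: after; exists c, k.
  by apply/eqP => /val_inj eq_kc; move: cWU; rewrite inE -eq_kc kU.
(* A larger [U] could lose some [y] and stay stable, by [stab_shift] from [W], against
   minimality. *)
have leUW : #|U| <= #|W|.
  rewrite leqNgt; apply/negP => ltWU.
  have /subsetPn [y yU yW] : ~~ (U \subset W).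
    by apply/negP => /subset_leq_card; lia.
  have sUy : stab (U :\ y).
    apply: (@stab_shift W); first by case: minW.
      by have := cardsD1 y U; rewrite yU; lia.
    move=> c k; rewrite !inE negb_and negbK => /andP [/orP [/eqP ->|cU] cW].
      by rewrite (negPf yW) in cW.
    by move=> /and3P [_ _ kU]; apply: ltUW; rewrite // inE cU.
  have := minU.2 _ sUy (subsetDl _ _) => eqU.
  by have := setD11 y U; rewrite eqU yU.
have nz : W :\: U != set0 by rewrite setD_eq0.
have := sum_after leUW nz ltUW => lt_sum.
have ltbad : #|W :&: P| < #|U :&: P|.
  rewrite ltn_neqAle le_bad andbT; apply/eqP => eq_bad.
  by move: le_key; rewrite /lq_key eq_bad; lia.
have /subsetPn [i] : ~~ (U :&: P \subset W :&: P).
  by apply/negP => /subset_leq_card; lia.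
rewrite !inE => /andP [iU iP]; rewrite iP andbT => iW.
have [c cWU sc] := bad_swap minU minW iP iU iW ltUW.
exists c, i; rewrite iP orbT; split=> //; apply/negP => cP.
case/negP: iW; apply: (initial_bad iP cP _ minW); first exact: ltUW.
by move: cWU; rewrite inE => /andP [].
Qed.

Lemma lq_key_subset (A B : {set 'I_n}) : A \subset B -> lq_key A <= lq_key B.
Proof.
move=> sAB; apply: leq_add.
  by rewrite leq_mul2l subset_leq_card ?orbT // setSI.
by rewrite [X in _ <= X](big_setID A) /= (setIidPr sAB) leq_addr.
Qed.

(** If [k] is in [P], the count in [P] drops by one, which outweighs any change of the index sum;
    otherwise [c < k] lowers the sum. *)
Lemma lq_key_swap (U : {set 'I_n}) (c k : 'I_n) : c \notin P -> c \notin U -> k \in U ->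
  (c < k) || (k \in P) -> lq_key (c |: U :\ k) < lq_key U.
Proof.
move=> cP cU kU disj.
have eqP' : (c |: U :\ k) :&: P = (U :&: P) :\ k.
  apply/setP => x; rewrite !inE; case: (eqVneq x c) => [->|_] /=; last by rewrite andbA.
  by rewrite (negPf cP) !andbF.
have sumE : \sum_(i in c |: U :\ k) i.+1 + k.+1 = \sum_(i in U) i.+1 + c.+1.
  rewrite big_setU1 ?inE ?negb_and ?cU ?orbT //= (big_setD1 k kU) /=.
  by rewrite addnC addnA [RHS]addnAC.
rewrite /lq_key eqP'; have [kP|kP] := boolP (k \in P).
  have := sum_lt_sq (c |: U :\ k).
  rewrite [#|U :&: P|](cardsD1 k) inE kU kP mulnDr muln1.
  by move=> lt; rewrite -addnA addnCA ltn_add2l; apply: leq_trans lt (leq_addr _ _).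
move: disj; rewrite (negPf kP) orbF => lt_ck.
have : n.+1 ^ 2 * #|(U :&: P) :\ k| <= n.+1 ^ 2 * #|U :&: P|.
  by rewrite leq_mul2l subset_leq_card ?orbT // subsetDl.
move=> le; rewrite -addnS; apply: leq_add => //.
by rewrite -(ltn_add2r k.+1) sumE ltn_add2l.
Qed.

Variable a : 'I_n -> nat.
Hypotheses (a_gt0 : forall i, 0 < a i) (a_good : forall c, c \notin P -> a c = 1).

Lemma linear_quotients_sets (t : seq {set 'I_n}) j :
  (forall A, A \in t <-> min_stab A /\ \sum_(i in A) a i <= j) ->
  uniq t -> pairwise (fun A B => lq_key B <= lq_key A) t ->
  linear_quotients [seq set_mon a A | A <- t].
Proof.
move=> tP uniq_t pw_t.
suff H t1 t2 : t = t1 ++ t2 -> linear_quotients [seq set_mon a A | A <- t2].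
  exact: (H [::]).
elim: t2 t1 => // U t2 IHt t1 tE /=; split.
  by apply: (IHt (rcons t1 U)); rewrite cat_rcons.
move=> _ /mapP [W Wt2 ->].
move: pw_t; rewrite tE pairwise_cat /= => /and4P [/allrelP lt1 _ /allP lt2 _].
move: uniq_t; rewrite tE cat_uniq /= => /and3P [_ _ /andP [Ut2 _]].
have [minU degU] : min_stab U /\ \sum_(i in U) a i <= j.
  by apply/tP; rewrite tE mem_cat mem_head orbT.
have [minW _] : min_stab W /\ \sum_(i in W) a i <= j.
  by apply/tP; rewrite tE mem_cat inE Wt2 !orbT.
have neqWU : W != U by apply: contraNneq Ut2 => <-.
have [c [k [cWU cP kU sV disj]]] := linear_quotient_step minU minW neqWU (lt2 _ Wt2).
move: cWU; rewrite inE => /andP [cU cW].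
have ac := a_good cP.
have [V minV sVU] := min_stab_below sV.
have ltkey : lq_key V < lq_key U.
  exact: leq_ltn_trans (lq_key_subset sVU) (lq_key_swap cP cU kU disj).
exists c, (set_mon a V); split.
- by rewrite !set_monE (negPf cU) cW.
- apply: map_f; have : V \in t.
    apply/tP; split=> //; apply: leq_trans degU.
    (* As [a c = 1 <= a k], the swap respects the degree bound [j]. *)
    apply: (@leq_trans (\sum_(i in c |: U :\ k) a i)).
      by rewrite [X in _ <= X](big_setID V) /= (setIidPr sVU) leq_addr.
    rewrite big_setU1 ?inE ?negb_and ?cU ?orbT //= (big_setD1 k kU) /= ac.
    by rewrite leq_add2r.
  (* The strictly smaller key places [V] after [U] in the list. *)
  rewrite tE mem_cat inE => /or3P [Vt1|/eqP eqVU|//].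
    by have := lt1 V U Vt1 (mem_head _ _); rewrite leqNgt ltkey.
  by rewrite eqVU ltnn in ltkey.
- apply/mnm_lepP => i; rewrite mnmDE !set_monE mnm1E.
  have := subsetP sVU i; rewrite !inE; case: (i \in V) => //= /(_ isT).
  case: (eqVneq i c) => [->|_] /=; first by rewrite ac addn1.
  by move=> /andP [_ ->]; rewrite leq_addr.
Qed.

End StronglyStable.

(** * Powers of squarefree lexsegment ideals *)

Section LexsegmentPowers.
Variables (K : fieldType) (n : nat) (I : {mpoly K[n]} -> Prop) (a : 'I_n -> nat).
Hypotheses (hI : squarefree_lexsegment I) (a_gt0 : forall i, 0 < a i).
Let stab (A : {set 'I_n}) := I 'X_[indic A].
Let P := [set i | 2 <= a i].

Lemma ideal_up (u v : 'X_{1..n}) : (u <= v)%MM -> I 'X_[u] -> I 'X_[v].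
Proof.
move=> uv; have [[G _ IG] _] := hI.
move/IG/mono_idealXP => [g Gg gu]; apply/IG/mono_idealXP; exists g => //.
exact: lepm_trans gu uv.
Qed.

Lemma stab_up (A B : {set 'I_n}) : A \subset B -> stab A -> stab B.
Proof. by move=> sAB; apply: ideal_up; exact: set_mon_leS. Qed.

Lemma lexsegment_swap (A : {set 'I_n}) (i k : 'I_n) :
  stab A -> k \in A -> i \notin A -> i < k -> stab (i |: A :\ k).
Proof.
move=> sA kA iA ik; apply: (hI.2 (indic A)) => //; try exact: indic_squarefree.
  by rewrite !mdeg_indic card_swap.
exists i; first by rewrite !set_monE setU11 (negPf iA).
move=> j ji; rewrite !set_monE !inE.
have -> : (j == i) = false by apply/eqP => eq_ji; rewrite eq_ji ltnn in ji.
have -> // : (j == k) = false by apply/eqP => eq_jk; rewrite eq_jk in ji; lia.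
Qed.

Lemma min_gen_indic A : min_gen I (indic A) <-> min_stab stab A.
Proof.
split=> -[sA minA]; split=> //.
  move=> B sB sBA; apply/eqP; rewrite eqEsubset sBA; apply: (@set_mon_le_sub _ (fun=> 1)) => //.
  by rewrite (minA _ sB) ?lepm_refl //; exact: set_mon_leS.
move=> v Iv le; have [|B vE] := @squarefree_indic _ v.
  by move=> i; apply: leq_trans (indic_squarefree A i); move/mnm_lepP: le.
rewrite vE in Iv le *; congr (indic _); apply: minA => //.
exact: set_mon_le_sub le.
Qed.

Lemma min_gen_setP u : min_gen I u <-> exists2 A, min_stab stab A & u = indic A.
Proof.
split=> [minu|[A minA ->]]; last exact/min_gen_indic.
have [A uE] := squarefree_indic (min_gen_squarefree hI.1 minu).
by exists A => //; apply/min_gen_indic; rewrite -uE.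
Qed.

Lemma mpow_indic A : mpow a (indic A) = set_mon a A.
Proof. by apply/mnmP => i; rewrite mnmE !set_monE; case: (i \in A). Qed.

(** An instance of [isolated_vertex_nonlinear] in the multidegree [set_mon a (l |: U)]. A generator
    leaving room for [l] and another variable would avoid [l], hence have support inside [U], hence
    equal to [U] by minimality, and then leave room only for [l]. *)
Lemma pow_nonlinear (U V : {set 'I_n}) l k : min_stab stab U -> min_stab stab V ->
  2 <= a l -> l \in V -> l \notin U -> V :\ l \subset U -> k \in U -> k \notin V ->
  \sum_(i in V) a i + 2 <= \sum_(i in U) a i + a l ->
  ~ componentwise_linear (ideal_pow a I).
Proof.
move=> minU minV al lV lU sVU kU kV degV.
have gen A : min_stab stab A ->
    exists2 u, min_gen I u & set_mon a A = mpow a u.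
  by move=> minA; exists (indic A); [exact/min_gen_indic | rewrite mpow_indic].
have lk : l != k by apply: contraNneq kV => <-.
have degUl : mdeg (set_mon a (l |: U)) = a l + \sum_(i in U) a i.
  by rewrite mdeg_set_mon big_setU1.
apply: (isolated_vertex_nonlinear (al := set_mon a (l |: U)) lk (gen _ minU) (gen _ minV)).
- apply/mnm_lepP => i; rewrite mnmDE !set_monE mnm1E in_setU1.
  by case: (eqVneq i l) => [->|_] /=; rewrite ?(negPf lU) ?addn0 //; lia.
- apply/mnm_lepP => i; rewrite mnmDE !set_monE mnm1E in_setU1.
  have := subsetP sVU i; rewrite in_setD1.
  case: (eqVneq k i) => [<-|_]; first by rewrite (negPf kV) kU orbT.
  rewrite addn0; case: (eqVneq i l) => [->|_] /=; rewrite ?lV //.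
  by case: (i \in V) => // /(_ isT) ->.
- by rewrite degUl mdeg_set_mon; lia.
- by rewrite degUl mdeg_set_mon; lia.
move=> i _ il [u /min_gen_setP [W minW ->] ->]; rewrite mpow_indic.
apply/negP => /mnm_lepP le.
have lW : l \notin W.
  by apply/negP => lW; have := le l; rewrite !mnmDE !set_monE !mnm1E lW setU11 eqxx; lia.
have sWU : W \subset U.
  apply/subsetP => x xW; have := le x; rewrite !mnmDE !set_monE xW in_setU1.
  case: (eqVneq x l) xW => [->|_ xW] /=; first by rewrite (negPf lW).
  by case: (x \in U) => //; have := a_gt0 x; lia.
have eqWU := minU.2 W minW.1 sWU.
have := le i; rewrite !mnmDE !set_monE !mnm1E eqxx eqWU in_setU1 (negPf il) /=.
by case: ifP; lia.
Qed.

(** If [U] were larger than [V], then [U :\: V] would have at least two elements, whose exponents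
    supply the degree gap of 2 in [pow_nonlinear]. *)
Lemma linear_exchange_card : componentwise_linear (ideal_pow a I) ->
  forall (l : 'I_n) (U V : {set 'I_n}), l \in P -> min_stab stab U ->
  min_stab stab V -> l \in V -> V :\ l \subset U -> #|U| <= #|V|.
Proof.
move=> lin l U V; rewrite inE => al minU minV lV sVU; rewrite leqNgt; apply/negP => ltVU.
have lU : l \notin U.
  apply/negP => lU; have sVU' : V \subset U by rewrite -(setD1K lV) subUset sub1set lU.
  by move: ltVU; rewrite (minU.2 V minV.1 sVU') ltnn.
have UV : U :&: V = V :\ l.
  apply/setP => x; rewrite !inE; have := subsetP sVU x; rewrite !inE.
  case: (eqVneq x l) => [->|_] /=; first by rewrite (negPf lU).
  by case: (x \in V) => [->|] //; rewrite andbF.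
have cardD : 2 <= #|U :\: V|.
  by move: ltVU; rewrite -(cardsID V U) UV (cardsD1 l V) lV addnC -addnS leq_add2l.
have /set0Pn [k] : U :\: V != set0 by rewrite -card_gt0; lia.
rewrite inE => /andP [kV kU].
apply: (pow_nonlinear minU minV al lV lU sVU kU kV) lin.
rewrite (big_setD1 l lV) /= [X in _ <= X + _](big_setID V) /= UV.
have : #|U :\: V| <= \sum_(i in U :\: V) a i.
  by rewrite -sum1_card; apply: leq_sum.
by move=> le; rewrite [a l + _]addnC addnAC leq_add2r leq_add2l (leq_trans cardD).
Qed.

(** If [U] missed [p], then [linear_exchange_card] would force the swapped set [p |: U :\ q] to be
    minimal; the gap of 2 in [pow_nonlinear] then comes from [a q >= 2]. *)
Lemma linear_initial_bad : componentwise_linear (ideal_pow a I) ->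
  forall (p q : 'I_n) (U : {set 'I_n}), p \in P -> q \in P -> p < q ->
  min_stab stab U -> q \in U -> p \in U.
Proof.
move=> lin p q U pP qP pq minU qU; apply: contraT => pU.
have [V minV sV] := min_stab_below (lexsegment_swap minU.1 qU pU pq).
have qp : q != p by apply: contraNneq pU => <-.
have qV : q \notin V.
  by apply/negP => /(subsetP sV); rewrite !inE eqxx (negPf qp).
have pV : p \in V.
  apply: contraR qV => pV; suff -> : V = U by [].
  apply: minU.2; first exact: minV.1.
  apply/subsetP => x xV; have := subsetP sV x xV; rewrite !inE.
  by case: eqVneq xV => [->|_ _ /andP [] //]; rewrite (negPf pV).
have sVU : V :\ p \subset U.
  apply/subsetP => x; rewrite !inE => /andP [xp /(subsetP sV)].
  by rewrite !inE (negPf xp) => /andP [].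
have VE : V = p |: U :\ q.
  apply/eqP; rewrite eqEcard sV card_swap //=.
  exact (linear_exchange_card lin pP minU minV pV sVU).
exfalso; apply: (pow_nonlinear minU minV _ pV pU sVU qU qV) lin.
  by move: pP; rewrite inE.
rewrite VE big_setU1 ?inE ?(negPf pU) ?andbF //= [X in _ <= X + _](big_setD1 q qU) /=.
by move: qP; rewrite inE => aq; rewrite -addnA [X in _ <= X]addnC leq_add2l addnC leq_add2r.
Qed.

Lemma exchange_linear :
  (forall (l : 'I_n) (U V : {set 'I_n}), l \in P -> min_stab stab U ->
     min_stab stab V -> l \in V -> V :\ l \subset U -> #|U| <= #|V|) ->
  (forall (p q : 'I_n) (U : {set 'I_n}), p \in P -> q \in P -> p < q ->
     min_stab stab U -> q \in U -> p \in U) ->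
  componentwise_linear (ideal_pow a I).
Proof.
move=> exch init j.
(* Minimality is a proposition; booleans chosen classically let the minimal sets be filtered into a
   list. *)
have /fin_all_exists [mins minsP] : forall A : {set 'I_n}, exists b : bool, min_stab stab A <-> b.
  by move=> A; have [?|?] := classic (min_stab stab A); [exists true | exists false].
pose t0 := [seq A <- enum {set 'I_n} | mins A & \sum_(i in A) a i <= j].
(* Decreasing keys, since [linear_quotients] has the last generator at the head. *)
pose t := sort (fun A B => lq_key P B <= lq_key P A) t0.
have tP A : A \in t <-> min_stab stab A /\ \sum_(i in A) a i <= j.
  rewrite mem_sort mem_filter mem_enum andbT; split; last by case=> /minsP -> ->.
  by case/andP=> /minsP.
have a_good c : c \notin P -> a c = 1 by rewrite inE; move: (a_gt0 c); lia.
have lq : linear_quotients [seq set_mon a A | A <- t].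
  apply: (linear_quotients_sets stab_up lexsegment_swap exch init a_gt0 a_good tP).
    by rewrite sort_uniq filter_uniq // enum_uniq.
  rewrite -sorted_pairwise; last by move=> B A C /= BA CB; exact: leq_trans CB BA.
  by apply: sort_sorted => A B; exact: leq_total.
rewrite /ideal_pow; apply: (linear_quotients_component K lq) => w.
split=> [/mapP [A /tP [minA degA] ->]|[[u /min_gen_setP [A minA ->] ->]]].
  rewrite mdeg_set_mon; split=> //; exists (indic A); first exact/min_gen_indic.
  by rewrite mpow_indic.
by rewrite mpow_indic mdeg_set_mon => degA; apply/map_f/tP.
Qed.

End LexsegmentPowers.

Theorem theorem2p3 (K : fieldType) (n : nat) (I : {mpoly K[n]} -> Prop)
    (a : 'I_n -> nat)
    (hI : squarefree_lexsegment I) (ha : forall i : 'I_n, 0 < a i) :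
  componentwise_linear (ideal_pow a I) <->
  (forall l : 'I_n, 2 <= a l ->
     ~ exists u v : 'X_{1..n},
         [/\ min_gen I u, min_gen I v, (U_(l) <= v)%MM,
             (v - U_(l) <= u)%MM & mdeg v < mdeg u]) /\
  (exists (s : nat) (i : 'I_s -> 'I_n),
     [/\ forall j k : 'I_s, j < k -> i j < i k,
         forall j : 'I_s, 2 <= a (i j),
         forall k : 'I_n, (forall j : 'I_s, k <> i j) -> a k = 1
       & forall j k : 'I_s, nat_of_ord k = j.+1 ->
           forall u : 'X_{1..n}, min_gen I u ->
             (U_(i k) <= u)%MM -> (U_(i j) <= u)%MM]).
Proof.
split=> [lin|[exch [s [i [i_lt ai_ge2 a_eq1 init]]]]].
  split=> [l al [_ [_ [/(min_gen_setP hI) [U minU ->] /(min_gen_setP hI) [V minV ->]]]]|].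
    rewrite lep1mP set_monE !mdeg_indic; case: ifP => // lV _ /(indic_le_sub1 _ lV) sVU.
    by rewrite ltnNge (linear_exchange_card hI ha lin _ minU minV lV sVU) // inE.
  (* The subset in (2) is forced: all indices with exponent at least 2, listed increasingly. *)
  pose P := [set i | 2 <= a i].
  exists #|P|, enum_val; split.
  - exact: enum_val_ord_lt.
  - by move=> j; have := enum_valP j; rewrite inE.
  - move=> k nk; have [kP|kP] := boolP (k \in P).
      by case: (nk (enum_rank_in kP k)); rewrite enum_rankK_in.
    by move: kP (ha k); rewrite inE; lia.
  move=> j k kj u /(min_gen_setP hI) [U minU ->]; rewrite !lep1mP !set_monE.
  case: ifP => // kU _; rewrite (linear_initial_bad hI ha lin _ _ _ minU kU) //.
  - exact: enum_valP.
  - exact: enum_valP.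
  - by apply: enum_val_ord_lt; rewrite kj.
have i_surj l : 2 <= a l -> exists j, l = i j.
  move=> al; apply: NNPP => nex; suff : a l = 1 by lia.
  by apply: a_eq1 => j lj; apply: nex; exists j.
(* Chains condition (2), stated for neighbours, over any gap; [d] is the gap minus one. *)
have init_lt d (j k : 'I_s) (U : {set 'I_n}) : nat_of_ord k = j + d.+1 ->
    min_stab (fun A => I 'X_[indic A]) U -> i k \in U -> i j \in U.
  move=> + minU; have step (j' k' : 'I_s) : nat_of_ord k' = j'.+1 -> i k' \in U -> i j' \in U.
    move=> eq_k /= kU; have := init j' k' eq_k (indic U).
    rewrite !lep1mP !set_monE kU; case: ifP => // _ /(_ _ isT) H.
    by have := H ((min_gen_indic I U).2 minU).
  elim: d k => [|d IHd] k eq_k; first by apply: step; rewrite eq_k addn1.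
  have lt_s : j + d.+1 < s by have := ltn_ord k; lia.
  by move=> kU; apply: (IHd (Ordinal lt_s)) => //; apply: step kU; rewrite eq_k addnS.
apply: exchange_linear => // [l U V|p q U].
  rewrite inE => al minU minV lV sVU; rewrite leqNgt; apply/negP => ltVU.
  apply: (exch l al); exists (indic U), (indic V); split.
  - exact/min_gen_indic.
  - exact/min_gen_indic.
  - by rewrite lep1mP set_monE lV.
  - exact/indic_le_sub1.
  - by rewrite !mdeg_indic.
rewrite !inE => /i_surj [j ->] /i_surj [k ->] lt_i minU.
have lt_jk : j < k.
  rewrite ltnNge leq_eqVlt; apply/negP => /orP [/eqP/val_inj eq_kj|/i_lt].
    by rewrite eq_kj ltnn in lt_i.
  by lia.
by apply: (init_lt (k - j.+1)) => //; lia.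
Qed.
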